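(* Let $K\subset X$ be an oriented knot, $X=S^3$ or $\mathbb R^3$. If $\mathcal F$ is a simple abelian sheaf on $X$ microsupported along the conormal bundle of $K$ (i.e. $\mathcal F\in\mathcal S$), then the assignment $$\epsilon_{\mathcal F}(\lambda)=\mathrm{tr}(\rho(\ell))-\mathrm{tr}(\rho'(K)),\quad \epsilon_{\mathcal F}(\mu)=\mathrm{tr}(\rho(m))-\dim V+1,\quad \epsilon_{\mathcal F}([\gamma])=\mathrm{tr}\left(\rho(\gamma)-\rho(m\gamma)\right)\ (\gamma\in\pi_K)$$ is an augmentation $\epsilon_{\mathcal F}:\mathcal P_K\to k$.
   Context: Fix a field $k$. $X=S^3$ or $\mathbb{R}^3$; $K\subset X$ is an oriented knot with closed embedding $i:K\to X$ and open embedding $j:X\setminus K\to X$; $\pi_K=\pi_1(X\setminus K)$, $e\in\pi_K$ the identity. Sheaves are sheaves of $k$-modules; local systems are of finite rank; $loc(Y)$ is the category of local systems on $Y$. Let $n(K)$ be a small tubular neighborhood of $K$. A meridian is a loop bounding an oriented disk that meets $K$ transversely in one point; the preferred meridian $m$ lies on $\partial n(K)$. The longitude $\ell$ is the intersection of $\partial n(K)$ with a Seifert surface, oriented like $K$. With base point on $\partial n(K)$, $m,\ell$ are commuting elements of $\pi_K$. $\Lambda_K$ is the conormal bundle of $K$ minus its zero section. $Mod_{\Lambda_K}(X)$ is the category of sheaves $\mathcal F$ on $X$ whose microsupport (Kashiwara–Schapira) is contained in $\Lambda_K$ away from the zero section; equivalently $j^{-1}\mathcal F\in loc(X\setminus K)$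 and $i^{-1}\mathcal F\in loc(K)$. Such $\mathcal F$ determines $\rho:\pi_K\to GL(V)$ ($V$ the stalk off $K$), $\rho':\mathbb{Z}_K\to GL(W)$ ($W$ the stalk at $x\in K$, $\mathbb Z_K=\pi_1(K)$ with generator $K$), and the restriction map $T:W=\mathcal F_x\cong\Gamma(B;\mathcal F)\to V$ ($B$ a small ball around $x$). $\mathcal F$ is simple if either $T$ is injective with rank $1$ cokernel or $T$ is surjective with rank $1$ kernel. $\mathcal S$ is the set of isomorphism classes of simple objects of $Mod_{\Lambda_K}(X)$. The framed cord algebra $\mathcal P_K$ is the tensor algebra over $\mathbb{Z}[\lambda^{\pm1},\mu^{\pm1}]$ freely generated by symbols $[\gamma]$, $\gamma\in\pi_K$, modulo: $[e]=1-\mu$; $[\gamma m]=[m\gamma]=\mu[\gamma]$ and $[\gamma\ell]=[\ell\gamma]=\lambda[\gamma]$; $[\gamma_1\gamma_2]-[\gamma_1m\gamma_2]-[\gamma_1][\gamma_2]=0$. An augmentation is a unit-preserving algebra homomorphism $\mathcal P_K\to k$; ''the assignment is an augmentation'' means that it extends to such a homomorphism. *)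

(* Defs.v *)
From HB Require Import structures.
From mathcomp Require Import all_boot all_order all_algebra.
From mathcomp Require Import all_classical all_reals all_analysis.
From mathcomp Require Import lra.

Set Implicit Arguments.
Unset Strict Implicit.
Unset Printing Implicit Defensive.

Import Order.TTheory GRing.Theory Num.Theory.
Import numFieldNormedType.Exports.

Local Open Scope classical_set_scope.
Local Open Scope quotient_scope.
Local Open Scope ring_scope.

(* Only the values of sec at open sets and of res at inclusions of open sets
   are meaningful. *)
Record sheaf (k : fieldType) (X : topologicalType) := Sheaf {
  sec :> set X -> lmodType k;
  res : forall U V : set X, {linear sec U -> sec V};
  res_id : forall U (s : sec U), open U -> res U U s = s;
  res_comp : forall U V W (s : sec U), open U -> open V -> open W ->
    V `<=` U -> W `<=` V -> res V W (res U V s) = res U W s;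
  sheaf_locality : forall (I : Type) (U : I -> set X),
    (forall i, open (U i)) ->
    forall s t : sec (\bigcup_i U i),
    (forall i, res _ (U i) s = res _ (U i) t) -> s = t;
  sheaf_gluing : forall (I : Type) (U : I -> set X),
    (forall i, open (U i)) ->
    forall s : forall i, sec (U i),
    (forall i j, res _ (U i `&` U j) (s i) = res _ (U i `&` U j) (s j)) ->
    exists t : sec (\bigcup_i U i), forall i, res _ (U i) t = s i
}.
Arguments res {k X} _ {U} V.

Section Stalk.
Context {k : fieldType} {X : topologicalType} (F : sheaf k X) (x : X).

Record local_section := LocalSection {
  ls_dom : set X;
  ls_nbhd : open_nbhs x ls_dom;
  ls_sec : F ls_dom
}.

Lemma ls_open s : open (ls_dom s).
Proof. exact: (proj1 (ls_nbhd s)). Qed.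

HB.instance Definition _ := gen_eqMixin local_section.
HB.instance Definition _ := gen_choiceMixin local_section.

Definition same_germ (s t : local_section) : bool :=
  `[< exists W, [/\ open_nbhs x W, W `<=` ls_dom s, W `<=` ls_dom t &
        res F W (ls_sec s) = res F W (ls_sec t)] >].

Lemma same_germ_refl : reflexive same_germ.
Proof. by move=> s; apply/asboolP; exists (ls_dom s); split=> //; exact: ls_nbhd. Qed.

Lemma same_germ_sym : symmetric same_germ.
Proof.
by move=> s t; apply/asboolP/asboolP=> -[W []]; exists W; split.
Qed.

Lemma res_eq_sub U V W W' (s : F U) (t : F V) :
  open U -> open V -> open W -> open W' -> W `<=` U -> W `<=` V ->
  W' `<=` W -> res F W s = res F W t -> res F W' s = res F W' t.
Proof.
move=> oU oV oW oW' WU WV W'W e.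
by rewrite -(@res_comp _ _ F U W W')// -(@res_comp _ _ F V W W')// e.
Qed.

Lemma same_germ_trans : transitive same_germ.
Proof.
move=> t s u /asboolP[W1 [ [op1 x1] s1 t1 e1]] /asboolP[W2 [ [op2 x2] t2 u2 e2]].
have [os opt ou] := And3 (ls_open s) (ls_open t) (ls_open u).
apply/asboolP; exists (W1 `&` W2); split.
- by split; [exact: openI|].
- by move=> y [/s1].
- by move=> y [_ /u2].
- have o12 := openI op1 op2.
  rewrite (res_eq_sub os opt op1 o12 s1 t1 _ e1); last exact: subIsetl.
  exact: (res_eq_sub opt ou op2 o12 t2 u2 (@subIsetr _ _ _) e2).
Qed.

Definition same_germ_equiv : equiv_rel local_section :=
  EquivRel same_germ same_germ_refl same_germ_sym same_germ_trans.

Definition stalk := {eq_quot same_germ_equiv}.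
HB.instance Definition _ := Choice.on stalk.

Lemma stalk_eqP (s t : local_section) :
  (\pi_stalk s = \pi_stalk t) <-> same_germ s t.
Proof. by split=> [/eqquotP|h]; [|apply/eqquotP]. Qed.

Lemma open_nbhs_setI U V : open_nbhs x U -> open_nbhs x V ->
  open_nbhs x (U `&` V).
Proof. by move=> [? ?] [? ?]; split; [exact: openI|]. Qed.

Lemma open_nbhs_setT : open_nbhs x [set: X].
Proof. by split; [exact: openT|]. Qed.

Definition ls0 := LocalSection open_nbhs_setT 0.
Definition ls_scale (a : k) s := LocalSection (ls_nbhd s) (a *: ls_sec s).
Definition ls_add s t :=
  LocalSection (open_nbhs_setI (ls_nbhd s) (ls_nbhd t))
    (res F _ (ls_sec s) + res F _ (ls_sec t)).

Definition stalk_zero : stalk := \pi_stalk ls0.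
Definition stalk_scale a (u : stalk) : stalk := \pi_stalk (ls_scale a (repr u)).
Definition stalk_opp (u : stalk) : stalk := stalk_scale (- 1) u.
Definition stalk_add (u v : stalk) : stalk := \pi_stalk (ls_add (repr u) (repr v)).

Lemma same_germ_repr s : same_germ (repr (\pi_stalk s)) s.
Proof. by apply/stalk_eqP; rewrite reprK. Qed.

Lemma stalk_scaleE a s : stalk_scale a (\pi_stalk s) = \pi_stalk (ls_scale a s).
Proof.
apply/stalk_eqP/asboolP.
have /asboolP[W [nW ? ? e]] := same_germ_repr s.
by exists W; split=> //=; rewrite !linearZ e.
Qed.

Lemma stalk_addE s t : stalk_add (\pi_stalk s) (\pi_stalk t) = \pi_stalk (ls_add s t).
Proof.
apply/stalk_eqP/asboolP.
have /asboolP[W1 [n1 s1 t1 e1]] := same_germ_repr s.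
have /asboolP[W2 [n2 s2 t2 e2]] := same_germ_repr t.
set s' := repr _ in s1 e1 *; set t' := repr _ in s2 e2 *.
have [os' ot' os ot] := And4 (ls_open s') (ls_open t') (ls_open s) (ls_open t).
have [[op1 _] [op2 _]] := (n1, n2).
have [os't' ost op12] := And3 (openI os' ot') (openI os ot) (openI op1 op2).
exists (W1 `&` W2); split=> //=; first exact: open_nbhs_setI.
- exact: setISS.
- exact: setISS.
- rewrite !linearD /= !res_comp//; try exact: setISS; try exact: subIsetl;
    try exact: subIsetr.
  by congr (_ + _);
    [apply: (res_eq_sub _ _ _ _ s1 t1 _ e1)|apply: (res_eq_sub _ _ _ _ s2 t2 _ e2)].
Qed.

Lemma stalk_eqW (s t : local_section) W : open_nbhs x W ->
  W `<=` ls_dom s -> W `<=` ls_dom t ->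
  res F W (ls_sec s) = res F W (ls_sec t) -> \pi_stalk s = \pi_stalk t.
Proof. by move=> ? ? ? ?; apply/stalk_eqP/asboolP; exists W. Qed.

Lemma stalk_addA : associative stalk_add.
Proof.
move=> u v w; rewrite -(reprK u) -(reprK v) -(reprK w).
move: (repr u) (repr v) (repr w) => r s t.
rewrite (stalk_addE s t) (stalk_addE r s) (stalk_addE r) (stalk_addE _ t).
have [nr [ns nt]] := (ls_nbhd r, (ls_nbhd s, ls_nbhd t)).
have nst := open_nbhs_setI ns nt; have nrs := open_nbhs_setI nr ns.
have nrst := open_nbhs_setI nr nst; have nrst' := open_nbhs_setI nrs nt.
case: (nr) (ns) (nt) (nst) (nrs) (nrst) (nrst') =>
  [? _] [? _] [? _] [? _] [? _] [? _] [? _].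
apply: (@stalk_eqW _ _ (ls_dom r `&` (ls_dom s `&` ls_dom t))) => //=.
  by move=> y [? []].
rewrite !linearD /= !res_comp ?addrA//;
  by move=> y [? []].
Qed.

Lemma stalk_addC : commutative stalk_add.
Proof.
move=> u v; rewrite -(reprK u) -(reprK v) !stalk_addE.
move: (repr u) (repr v) => s t.
have [ns nt] := (ls_nbhd s, ls_nbhd t).
have nst := open_nbhs_setI ns nt; have nts := open_nbhs_setI nt ns.
case: (ns) (nt) (nst) (nts) => [? _] [? _] [? _] [? _].
apply: (@stalk_eqW _ _ (ls_dom s `&` ls_dom t)) => //=; first by move=> y [].
by rewrite !linearD /= !res_comp 1?addrC//; move=> y [].
Qed.

Lemma stalk_add0 : left_id stalk_zero stalk_add.
Proof.
move=> u; rewrite -(reprK u); move: (repr u) => s; rewrite (stalk_addE ls0 s).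
have ns := ls_nbhd s; have nT := open_nbhs_setI open_nbhs_setT ns.
case: (ns) (nT) => [? _] [? _].
apply: (@stalk_eqW _ _ (ls_dom s)) => //=.
by rewrite !linearD /= !linear0 add0r res_comp// setTI.
Qed.

Lemma stalk_addN : left_inverse stalk_zero stalk_opp stalk_add.
Proof.
move=> u; rewrite /stalk_opp -(reprK u); move: (repr u) => s.
rewrite (stalk_scaleE _ s) (stalk_addE (ls_scale _ s)).
have ns := ls_nbhd s; have nI := open_nbhs_setI ns ns.
case: (ns) (nI) => [? _] [? _].
apply: (@stalk_eqW _ _ (ls_dom s)) => //=.
by rewrite scaleN1r linearN /= addNr !linear0.
Qed.

HB.instance Definition _ := GRing.isZmodule.Build stalk
  stalk_addA stalk_addC stalk_add0 stalk_addN.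

Lemma stalk_scaleA a b u : stalk_scale a (stalk_scale b u) = stalk_scale (a * b) u.
Proof. rewrite -(reprK u) (stalk_scaleE b) (stalk_scaleE a) (stalk_scaleE (a * b)).
by rewrite /ls_scale /= scalerA. Qed.

Lemma stalk_scale1 : left_id 1 stalk_scale.
Proof.
move=> u; rewrite -[RHS](reprK u) -(reprK u) stalk_scaleE reprK.
by case: (repr u) => U n s; rewrite /ls_scale /= scale1r.
Qed.

Lemma stalk_scaleDr : right_distributive stalk_scale +%R.
Proof.
move=> a u v; rewrite -(reprK u) -(reprK v) /GRing.add /=.
move: (repr u) (repr v) => s t.
rewrite (stalk_addE s t) !(stalk_scaleE a) (stalk_addE (ls_scale a s)).
by rewrite /ls_scale /ls_add /= scalerDr !linearZ.
Qed.

Lemma stalk_scaleDl u : {morph stalk_scale^~ u : a b / a + b}.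
Proof.
move=> a b; rewrite -(reprK u); move: (repr u) => s.
rewrite !(stalk_scaleE _ s) [RHS](stalk_addE (ls_scale a s) (ls_scale b s)).
have ns := ls_nbhd s; have nI := open_nbhs_setI ns ns.
case: (ns) (nI) => [? _] [? _].
apply: (@stalk_eqW _ _ (ls_dom s)) => //=.
rewrite linearD /= !res_comp//; try by rewrite setIid.
by rewrite -linearD /= -scalerDl.
Qed.

HB.instance Definition _ := GRing.Zmodule_isLmodule.Build k stalk
  stalk_scaleA stalk_scale1 stalk_scaleDr stalk_scaleDl.

(* The germ at x of a section over U; it is the zero germ when U is not an open
   neighbourhood of x. *)
Definition germ (U : set X) (s : F U) : stalk :=
  if pselect (open_nbhs x U) is left nU then \pi_stalk (LocalSection nU s) else 0.

End Stalk.
Arguments germ {k X} F x {U} s.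

Section InverseImage.
Context {k : fieldType} {X : topologicalType} (F : sheaf k X).

(* The sections over V of the inverse image of F along f: families of germs
   that are locally induced by sections of F. *)
Definition pullback_section (Y : topologicalType) (f : Y -> X) (V : set Y)
    (s : forall y, stalk F (f y)) : Prop :=
  forall y, V y -> exists (U : set X) (u : F U), open_nbhs (f y) U /\
    \forall y' \near within V (nbhs y), U (f y') /\ s y' = germ F (f y') u.
Arguments pullback_section {Y} f V s.

(* The inverse image of F along f is locally isomorphic to a constant sheaf k^n.
   Such an isomorphism of sheaves over V amounts to linear isomorphisms phi on
   the stalks under which the sections over each open subset of V correspond to
   the locally constant functions. *)
Definition pullback_local_system (Y : topologicalType) (f : Y -> X) : Prop :=
  forall y0 : Y, exists (V : set Y) (n : nat)
      (phi : forall y, {linear stalk F (f y) -> 'rV[k]_n}),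
    [/\ open_nbhs y0 V,
        forall y, V y -> bijective (phi y) &
        forall (W : set Y) (s : forall y, stalk F (f y)),
          open W -> W `<=` V ->
          (pullback_section f W s <->
           forall y, W y -> \forall y' \near y, phi y' (s y') = phi y (s y))].

(* The section of the inverse image of F on [0, 1] is followed from c 1 to c 0:
   as (c d) runs through c first, this makes monodromy a homomorphism for the
   composition of linear maps. *)
Definition monodromy (R : realType) (c : R -> X) (x : X) (v : stalk F x) :
    stalk F x :=
  xget 0 [set w | exists s : forall t, stalk F (c t),
    [/\ pullback_section c [set` `[0, 1]] s,
        existT (stalk F) (c 1) (s 1) = existT (stalk F) x v &
        existT (stalk F) (c 0) (s 0) = existT (stalk F) x w]].

End InverseImage.

Section FiniteDimension.
Context {k : fieldType}.

(* A chosen linear isomorphism from V to k^n, when V has finite dimension. *)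
Definition coordinates (V : lmodType k) : {n : nat & V -> 'rV[k]_n} :=
  xget (existT (fun n => V -> 'rV[k]_n) 0%N (fun=> 0))
    [set e | linear (tagged e) /\ bijective (tagged e)].

Definition dimension (V : lmodType k) : nat := tag (coordinates V).

Definition trace (V : lmodType k) (f : V -> V) : k :=
  let e := tagged (coordinates V) in
  \tr (\matrix_i e (f (xget 0 [set v | e v = delta_mx 0 i]))).

Definition rank1_kernel (V W : lmodType k) (T : {linear V -> W}) : Prop :=
  exists2 w : V, w != 0 & forall v, T v = 0 <-> exists a, v = a *: w.

Definition rank1_cokernel (V W : lmodType k) (T : {linear V -> W}) : Prop :=
  exists p : {linear W -> k^o}, (forall a, exists w, p w = a) /\
    forall w, p w = 0 <-> exists v, T v = w.

End FiniteDimension.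

Section WithinContinuity.
Context {S T U : topologicalType}.

Lemma within_comp (A : set S) (B : set T) (f : S -> T) (g : T -> U) :
  {within A, continuous f} -> {within B, continuous g} ->
  (forall x, A x -> B (f x)) -> {within A, continuous (g \o f)}.
Proof.
move=> /subspace_continuousP cf /subspace_continuousP cg AB.
apply/subspace_continuousP => x Ax V nV.
have := cf x Ax _ (cg (f x) (AB x Ax) V nV).
rewrite /= !nbhs_simpl /within /=.
by apply: filterS => y h Ay; apply: h => //; exact: AB.
Qed.

Lemma within_eq (A : set S) (f g : S -> T) :
  (forall x, A x -> f x = g x) ->
  {within A, continuous f} -> {within A, continuous g}.
Proof.
by move=> fg cf; apply: (subspace_eq_continuous _ cf) => x /set_mem; exact: fg.
Qed.

End WithinContinuity.

Lemma within_paste {R : realType} {S T : topologicalType} (A : set S)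
    (phi : S -> R) (c : R) (f g h : S -> T) :
  closed A -> continuous phi ->
  {within A `&` [set x | phi x <= c], continuous f} ->
  {within A `&` [set x | c <= phi x], continuous g} ->
  (forall x, A x -> phi x <= c -> h x = f x) ->
  (forall x, A x -> c <= phi x -> h x = g x) ->
  {within A, continuous h}.
Proof.
move=> cA cphi cf cg hf hg.
have -> : A = (A `&` [set x | phi x <= c]) `|` (A `&` [set x | c <= phi x]).
  apply/seteqP; split=> x; last by move=> [] [].
  by move=> Ax; have [?|/ltW ?] := leP (phi x) c; [left|right].
apply: withinU_continuous.
- apply: closedI => //; apply: (@preimage_closed _ _ phi [set` `]-oo, c]]).
    by move=> ? _; exact: cphi.
  exact: interval_closed.
- apply: closedI => //.
  rewrite (_ : mkset _ = phi @^-1` [set` `[c, +oo[]); last first.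
    by apply/seteqP; split=> x /=; rewrite in_itv/= andbT.
  apply: preimage_closed.
    by move=> ? _; exact: cphi.
  exact: interval_closed.
- by apply: (within_eq _ cf) => x [? ?]; rewrite hf.
- by apply: (within_eq _ cg) => x [? ?]; rewrite hg.
Qed.

Section FundamentalGroup.
Context {R : realType} {Y : topologicalType} (y : Y).

Definition unit_square : set (R * R) := `[0, 1] `*` `[0, 1].

Record loop := Loop {
  loop_fun :> R -> Y;
  loop_continuous : {within `[0, 1], continuous loop_fun};
  loop_start : loop_fun 0 = y;
  loop_end : loop_fun 1 = y
}.

HB.instance Definition _ := gen_eqMixin loop.
HB.instance Definition _ := gen_choiceMixin loop.

Definition loop_homotopy (c d : loop) (H : R * R -> Y) : Prop :=
  {within unit_square, continuous H} /\
  forall t, 0 <= t <= 1 ->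
    [/\ H (0, t) = c t, H (1, t) = d t, H (t, 0) = y & H (t, 1) = y].

Definition homotopic (c d : loop) : bool := `[< exists H, loop_homotopy c d H >].

Lemma unit_squareP s t : unit_square (s, t) <-> 0 <= s <= 1 /\ 0 <= t <= 1.
Proof. by rewrite /unit_square /= !in_itv. Qed.

Lemma unit_intervalP t : `[0, 1]%classic t <-> (0 : R) <= t <= 1.
Proof. by rewrite /= in_itv. Qed.

Lemma closed_square : closed unit_square.
Proof.
have -> : unit_square = (fst @^-1` `[0, 1]) `&` (snd @^-1` `[0, 1]) by [].
by apply: closedI; apply: preimage_closed => [? _|];
  [exact: cvg_fst|exact: itv_closed|exact: cvg_snd|exact: itv_closed].
Qed.

Lemma homotopic_comp (c : loop) (h : R * R -> R) (d e : loop) :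
  {within unit_square, continuous h} ->
  (forall s t, 0 <= s <= 1 -> 0 <= t <= 1 -> 0 <= h (s, t) <= 1) ->
  (forall t, 0 <= t <= 1 -> c (h (0, t)) = d t /\ c (h (1, t)) = e t) ->
  (forall s, 0 <= s <= 1 -> c (h (s, 0)) = y /\ c (h (s, 1)) = y) ->
  homotopic d e.
Proof.
move=> ch h01 hde hy; apply/asboolP; exists (c \o h); split.
  apply: (within_comp ch (@loop_continuous c)) => -[s t] /unit_squareP[? ?].
  by apply/unit_intervalP; exact: h01.
by move=> t t01 /=; have [? ?] := hde t t01; have [? ?] := hy t t01; split.
Qed.

Lemma homotopic_eq (c d : loop) :
  (forall t, 0 <= t <= 1 -> c t = d t) -> homotopic c d.
Proof.
move=> cd; apply: (@homotopic_comp c snd).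
- by apply: continuous_subspaceT => ?; exact: cvg_snd.
- by [].
- by move=> t t01 /=; split=> //; exact: cd.
- by move=> s s01 /=; rewrite loop_start loop_end.
Qed.

Lemma homotopic_refl : reflexive homotopic.
Proof. by move=> c; exact: homotopic_eq. Qed.

Lemma cont_pairR (f g : R * R -> R) :
  continuous f -> continuous g -> continuous (fun p => (f p, g p)).
Proof. by move=> cf cg p; exact: (cvg_pair (cf p) (cg p)). Qed.

Lemma cont_fst : continuous (fst : R * R -> R).
Proof. by move=> ?; exact: cvg_fst. Qed.

Lemma cont_snd : continuous (snd : R * R -> R).
Proof. by move=> ?; exact: cvg_snd. Qed.

Lemma cont_affine (f : R * R -> R) a b :
  continuous f -> continuous (fun p => a * f p + b).
Proof.
move=> cf p; apply: cvgD; last exact: cvg_cst.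
by apply: cvgM; [exact: cvg_cst|exact: cf].
Qed.

Lemma contR_affine a b : continuous (fun t : R => a * t + b).
Proof.
move=> p; apply: cvgD; last exact: cvg_cst.
by apply: cvgM; [exact: cvg_cst|exact: cvg_id].
Qed.

Lemma homotopic_sym : symmetric homotopic.
Proof.
suff sub c d : homotopic c d -> homotopic d c.
  by move=> c d; apply/idP/idP; exact: sub.
move=> /asboolP[H [cH bH]]; apply/asboolP.
exists (H \o (fun p => (-1 * p.1 + 1, p.2))); split.
  apply: (within_comp _ cH).
    apply: continuous_subspaceT; apply: cont_pairR (cont_snd).
    exact/cont_affine/cont_fst.
  by move=> [s t] /unit_squareP[? ?]; apply/unit_squareP; split=> //=; lra.
move=> t t01 /=.
have t01' : 0 <= -1 * t + 1 <= 1 by lra.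
have [e1 e2 e3 e4] := bH _ t01'.
have [f1 f2 f3 f4] := bH t t01.
by split; rewrite ?mulr0 ?mulr1 ?add0r ?addNr.
Qed.

Lemma homotopic_trans : transitive homotopic.
Proof.
move=> d c e /asboolP[H [cH bH]] /asboolP[G [cG bG]]; apply/asboolP.
exists (fun p => if p.1 <= 2^-1 then H (2 * p.1 + 0, p.2)
                 else G (2 * p.1 + -1, p.2)); split.
  apply: (@within_paste R _ _ unit_square fst 2^-1
    (H \o (fun p => (2 * p.1 + 0, p.2))) (G \o (fun p => (2 * p.1 + -1, p.2)))).
  - exact: closed_square.
  - exact: cont_fst.
  - apply: (within_comp _ cH).
      apply: continuous_subspaceT; apply: cont_pairR (cont_snd).
      exact/cont_affine/cont_fst.
    by move=> [s t] /= [/unit_squareP[? ?] ?]; apply/unit_squareP; split=> //=; lra.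
  - apply: (within_comp _ cG).
      apply: continuous_subspaceT; apply: cont_pairR (cont_snd).
      exact/cont_affine/cont_fst.
    by move=> [s t] /= [/unit_squareP[? ?] ?]; apply/unit_squareP; split=> //=; lra.
  - by move=> [s t] _ /= ->.
  - move=> [s t] /unit_squareP[s01 t01] /= s2; case: ifPn => // s2'.
    have -> : s = 2^-1 by apply/eqP; rewrite eq_le s2 s2'.
    rewrite (_ : 2 * 2^-1 + 0 = 1); last lra.
    rewrite (_ : 2 * 2^-1 + -1 = 0); last lra.
    by have [_ -> _ _] := bH t t01; have [-> _ _ _] := bG t t01.
move=> t t01 /=; rewrite invr_ge0 ler0n.
rewrite (_ : (1 <= 2^-1 :> R) = false); last by apply/negbTE; rewrite -ltNge; lra.
rewrite mulr0 addr0 mulr1 (_ : 2 + -1 = 1); last lra.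
have [-> _ _ _] := bH t t01; have [_ -> _ _] := bG t t01.
split=> //.
- case: ifP => ht.
    have t01' : 0 <= 2 * t + 0 <= 1 by lra.
    by have [_ _ ->] := bH _ t01'.
  move/negbT: ht; rewrite -ltNge => ht.
  have t01' : 0 <= 2 * t + -1 <= 1 by lra.
  by have [_ _ ->] := bG _ t01'.
- case: ifP => ht.
    have t01' : 0 <= 2 * t + 0 <= 1 by lra.
    by have [_ _ _ ->] := bH _ t01'.
  move/negbT: ht; rewrite -ltNge => ht.
  have t01' : 0 <= 2 * t + -1 <= 1 by lra.
  by have [_ _ _ ->] := bG _ t01'.
Qed.

Lemma homotopic_reparam (c d e : loop) (f g : R -> R) :
  continuous f -> continuous g ->
  (forall t, 0 <= t <= 1 -> 0 <= f t <= 1) ->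
  (forall t, 0 <= t <= 1 -> 0 <= g t <= 1) ->
  f 0 = g 0 -> f 1 = g 1 ->
  (forall t, 0 <= t <= 1 -> d t = c (f t)) ->
  (forall t, 0 <= t <= 1 -> e t = c (g t)) -> homotopic d e.
Proof.
move=> cf cg f01 g01 fg0 fg1 df eg.
have i0 : 0 <= (0 : R) <= 1 by lra.
have i1 : 0 <= (1 : R) <= 1 by lra.
apply: (@homotopic_comp c (fun p => (-1 * p.1 + 1) * f p.2 + p.1 * g p.2)).
- apply: continuous_subspaceT => p; apply: cvgD; apply: cvgM.
  + exact/cont_affine/cont_fst.
  + by apply: continuous_comp; [exact: cont_snd|exact: cf].
  + exact: cont_fst.
  + by apply: continuous_comp; [exact: cont_snd|exact: cg].
- move=> s t s01 t01 /=; have := f01 t t01; have := g01 t t01.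
  by move: (f t) (g t) => u v ? ?; nra.
- move=> t t01 /=; rewrite mulr0 mulr1 add0r addNr !mul0r !mul1r add0r addr0.
  by rewrite df// eg.
- move=> s s01 /=; rewrite -fg0 -fg1 -!mulrDl.
  rewrite (_ : -1 * s + 1 + s = 1); last lra.
  by rewrite !mul1r -!df// loop_start loop_end.
Qed.

Definition cat_fun (c d : R -> Y) (t : R) : Y :=
  if t <= 2^-1 then c (2 * t + 0) else d (2 * t + -1).

Lemma half_lt1 : (1 <= 2^-1 :> R) = false.
Proof. by apply/negbTE; rewrite -ltNge; lra. Qed.

Lemma cat_fun_paste (S : topologicalType) (A : set S) (phi : S -> R)
    (f g h : S -> Y) : closed A -> continuous phi ->
  {within A `&` [set x | phi x <= 2^-1], continuous f} ->
  {within A `&` [set x | 2^-1 <= phi x], continuous g} ->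
  (forall x, A x -> phi x = 2^-1 -> f x = g x) ->
  (forall x, A x -> h x = if phi x <= 2^-1 then f x else g x) ->
  {within A, continuous h}.
Proof.
move=> cA cphi cf cg fg hE; apply: (within_paste cA cphi cf cg).
  by move=> x Ax p; rewrite hE// p.
move=> x Ax p; rewrite hE//; case: ifPn => // p'.
by apply: fg => //; apply/eqP; rewrite eq_le p p'.
Qed.

Lemma loop_cat_continuous (c d : loop) :
  {within `[0, 1], continuous (cat_fun c d)}.
Proof.
apply: (@cat_fun_paste _ _ id (c \o (fun t => 2 * t + 0))
  (d \o (fun t => 2 * t + -1))).
- exact: itv_closed.
- by move=> ?; exact: cvg_id.
- apply: (within_comp _ (@loop_continuous c)).
    exact/continuous_subspaceT/contR_affine.
  by move=> t /= [/unit_intervalP ? ?]; apply/unit_intervalP; lra.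
- apply: (within_comp _ (@loop_continuous d)).
    exact/continuous_subspaceT/contR_affine.
  by move=> t /= [/unit_intervalP ? ?]; apply/unit_intervalP; lra.
- move=> t _ /= ->; rewrite (_ : 2 * 2^-1 + 0 = 1); last lra.
  by rewrite (_ : 2 * 2^-1 + -1 = 0) ?loop_start ?loop_end//; lra.
- by [].
Qed.

Lemma loop_cat_start (c d : loop) : cat_fun c d 0 = y.
Proof. by rewrite /cat_fun invr_ge0 ler0n mulr0 addr0 loop_start. Qed.

Lemma loop_cat_end (c d : loop) : cat_fun c d 1 = y.
Proof.
by rewrite /cat_fun half_lt1 (_ : 2 * 1 + -1 = 1) ?loop_end//; lra.
Qed.

Definition loop_cat c d : loop :=
  Loop (@loop_cat_continuous c d) (loop_cat_start c d) (loop_cat_end c d).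

Lemma loop_rev_continuous (c : loop) :
  {within `[0, 1], continuous (fun t => c (-1 * t + 1))}.
Proof.
apply: (within_comp _ (@loop_continuous c)).
  exact/continuous_subspaceT/contR_affine.
by move=> t /unit_intervalP ?; apply/unit_intervalP; lra.
Qed.

Lemma loop_rev_start (c : loop) : c (-1 * 0 + 1) = y.
Proof. by rewrite mulr0 add0r loop_end. Qed.

Lemma loop_rev_end (c : loop) : c (-1 * 1 + 1) = y.
Proof. by rewrite mulr1 addNr loop_start. Qed.

Definition loop_rev c : loop :=
  Loop (@loop_rev_continuous c) (loop_rev_start c) (loop_rev_end c).

Lemma loop_cst_continuous : {within `[0 : R, 1], continuous (fun=> y)}.
Proof. exact/continuous_subspaceT/cst_continuous. Qed.

Definition loop_cst : loop := Loop loop_cst_continuous erefl erefl.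

Definition homotopic_equiv : equiv_rel loop :=
  EquivRel homotopic homotopic_refl homotopic_sym homotopic_trans.

Definition pi1 := {eq_quot homotopic_equiv}.
HB.instance Definition _ := Choice.on pi1.

Definition loop_class (c : loop) : pi1 := \pi_pi1 c.

Lemma loop_classP (c d : loop) : loop_class c = loop_class d <-> homotopic c d.
Proof. by split=> [/eqquotP|h]; [|apply/eqquotP]. Qed.

Lemma loop_class_repr (u : pi1) : loop_class (repr u) = u.
Proof. exact: reprK. Qed.

Definition pi1_one : pi1 := loop_class loop_cst.
Definition pi1_mul (u v : pi1) : pi1 := loop_class (loop_cat (repr u) (repr v)).
Definition pi1_inv (u : pi1) : pi1 := loop_class (loop_rev (repr u)).

Lemma homotopic_cat (c c' d d' : loop) :
  homotopic c c' -> homotopic d d' -> homotopic (loop_cat c d) (loop_cat c' d').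
Proof.
move=> /asboolP[H [cH bH]] /asboolP[G [cG bG]]; apply/asboolP.
exists (fun p => if p.2 <= 2^-1 then H (p.1, 2 * p.2 + 0)
                 else G (p.1, 2 * p.2 + -1)); split.
  apply: (@cat_fun_paste _ unit_square snd
    (H \o (fun p => (p.1, 2 * p.2 + 0))) (G \o (fun p => (p.1, 2 * p.2 + -1)))).
  - exact: closed_square.
  - exact: cont_snd.
  - apply: (within_comp _ cH).
      apply: continuous_subspaceT; apply: (cont_pairR cont_fst).
      exact/cont_affine/cont_snd.
    by move=> [s t] /= [/unit_squareP[? ?] ?]; apply/unit_squareP; split=> //=; lra.
  - apply: (within_comp _ cG).
      apply: continuous_subspaceT; apply: (cont_pairR cont_fst).
      exact/cont_affine/cont_snd.
    by move=> [s t] /= [/unit_squareP[? ?] ?]; apply/unit_squareP; split=> //=; lra.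
  - move=> [s t] /unit_squareP[s01 t01] /= ->.
    rewrite (_ : 2 * 2^-1 + 0 = 1); last lra.
    rewrite (_ : 2 * 2^-1 + -1 = 0); last lra.
    by have [_ _ _ ->] := bH s s01; have [_ _ -> _] := bG s s01.
  - by [].
move=> t t01 /=; rewrite invr_ge0 ler0n half_lt1 /cat_fun.
have [_ _ h0 _] := bH t t01; have [_ _ _ g1] := bG t t01.
rewrite (_ : 2 * 0 + 0 = 0); last lra.
rewrite (_ : 2 * 1 + -1 = 1); last lra.
rewrite h0 g1.
split=> //; case: ifPn => ht.
- have t01' : 0 <= 2 * t + 0 <= 1 by lra.
  by have [-> _ _ _] := bH _ t01'.
- rewrite -ltNge in ht; have t01' : 0 <= 2 * t + -1 <= 1 by lra.
  by have [-> _ _ _] := bG _ t01'.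
- have t01' : 0 <= 2 * t + 0 <= 1 by lra.
  by have [_ -> _ _] := bH _ t01'.
- rewrite -ltNge in ht; have t01' : 0 <= 2 * t + -1 <= 1 by lra.
  by have [_ -> _ _] := bG _ t01'.
Qed.

Lemma homotopic_repr (c : loop) : homotopic (repr (loop_class c)) c.
Proof. by apply/loop_classP; exact: loop_class_repr. Qed.

Lemma pi1_mulE (c d : loop) :
  pi1_mul (loop_class c) (loop_class d) = loop_class (loop_cat c d).
Proof. by apply/loop_classP; apply: homotopic_cat; exact: homotopic_repr. Qed.

Lemma cont_min (f g : R -> R) : continuous f -> continuous g ->
  continuous (fun t => Num.min (f t) (g t)).
Proof.
by move=> cf cg x; apply: (@continuous_min R R f g x); [exact: cf|exact: cg].
Qed.

Lemma cont_max (f g : R -> R) : continuous f -> continuous g ->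
  continuous (fun t => Num.max (f t) (g t)).
Proof.
by move=> cf cg x; apply: (@continuous_max R R f g x); [exact: cf|exact: cg].
Qed.

Lemma cont_idR : continuous (fun t : R => t).
Proof. by move=> ?; exact: cvg_id. Qed.

Lemma pi1_mulA : associative pi1_mul.
Proof.
move=> u v w; rewrite -(loop_class_repr u) -(loop_class_repr v).
rewrite -(loop_class_repr w); move: (repr u) (repr v) (repr w) => b c d.
rewrite (pi1_mulE c d) (pi1_mulE b c) (pi1_mulE b) (pi1_mulE _ d).
apply/loop_classP.
pose f t : R := Num.min (Num.min (2 * t + 0) (1 * t + 4^-1)) (2^-1 * t + 2^-1).
rewrite homotopic_sym.
apply: (@homotopic_reparam (loop_cat b (loop_cat c d)) _ _ f id).
- by apply: cont_min; [apply: cont_min|]; exact: contR_affine.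
- exact: cont_idR.
- by move=> t t01; rewrite /f !minElt; do !case: ifPn; rewrite -?leNgt => *; lra.
- by [].
- by rewrite /f !minElt; do !case: ifPn; rewrite -?leNgt => *; lra.
- by rewrite /f !minElt; do !case: ifPn; rewrite -?leNgt => *; lra.
- move=> t t01; rewrite /= /cat_fun /f /=.
  have [t4|t4] := leP t 4^-1.
    rewrite (_ : Num.min _ _ = 2 * t + 0); last first.
      by rewrite !minElt; do !case: ifPn; rewrite -?leNgt => *; lra.
    do !case: ifPn; rewrite -?ltNge => *; try (by exfalso; lra).
    by congr (b _); lra.
  have [t2|t2] := leP t 2^-1.
    rewrite (_ : Num.min _ _ = 1 * t + 4^-1); last first.
      by rewrite !minElt; do !case: ifPn; rewrite -?leNgt => *; lra.
    do !case: ifPn; rewrite -?ltNge => *; try (by exfalso; lra).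
    by congr (c _); lra.
  rewrite (_ : Num.min _ _ = 2^-1 * t + 2^-1); last first.
    by rewrite !minElt; do !case: ifPn; rewrite -?leNgt => *; lra.
  do !case: ifPn; rewrite -?ltNge => *; try (by exfalso; lra).
  by congr (d _); lra.
- by [].
Qed.

Lemma pi1_mul1 : left_id pi1_one pi1_mul.
Proof.
move=> u; rewrite -(loop_class_repr u); move: (repr u) => c.
rewrite pi1_mulE; apply/loop_classP.
apply: (@homotopic_reparam c _ _ (fun t => Num.max 0 (2 * t + -1)) id) => //.
- by apply: cont_max; [exact: cst_continuous|exact: contR_affine].
- exact: cont_idR.
- by move=> t t01; rewrite maxElt; case: ifPn; rewrite -?leNgt => *; lra.
- by rewrite maxElt; case: ifPn; rewrite -?leNgt => *; lra.
- by rewrite maxElt; case: ifPn; rewrite -?leNgt => *; lra.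
- move=> t t01 /=; rewrite /cat_fun /= maxElt.
  do !case: ifPn; rewrite -?leNgt -?ltNge => *; try (by exfalso; lra); try by [].
  by rewrite loop_start.
Qed.

Lemma pi1_mulr1 : right_id pi1_one pi1_mul.
Proof.
move=> u; rewrite -(loop_class_repr u); move: (repr u) => c.
rewrite pi1_mulE; apply/loop_classP.
apply: (@homotopic_reparam c _ _ (fun t => Num.min (2 * t + 0) 1) id) => //.
- by apply: cont_min; [exact: contR_affine|exact: cst_continuous].
- exact: cont_idR.
- by move=> t t01; rewrite minElt; case: ifPn; rewrite -?leNgt => *; lra.
- by rewrite minElt; case: ifPn; rewrite -?leNgt => *; lra.
- by rewrite minElt; case: ifPn; rewrite -?leNgt => *; lra.
- move=> t t01 /=; rewrite /cat_fun /= minElt.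
  do !case: ifPn; rewrite -?leNgt -?ltNge => *; try (by exfalso; lra); try by [].
    by congr (c _); lra.
  by rewrite loop_end.
Qed.

Lemma loop_cat_rev (c : loop) :
  homotopic (loop_cat c (loop_rev c)) loop_cst.
Proof.
apply: (@homotopic_reparam c _ _
  (fun t => Num.min (2 * t + 0) (-2 * t + 2)) (fun=> 0)).
- by apply: cont_min; exact: contR_affine.
- exact: cst_continuous.
- by move=> t t01; rewrite minElt; case: ifPn; rewrite -?leNgt => *; lra.
- by move=> t t01; lra.
- by rewrite minElt; case: ifPn; rewrite -?leNgt => *; lra.
- by rewrite minElt; case: ifPn; rewrite -?leNgt => *; lra.
- move=> t t01 /=; rewrite /cat_fun /= minElt.
  do !case: ifPn; rewrite -?leNgt -?ltNge => *; try (by exfalso; lra); try by [];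
    by congr (c _); lra.
- by move=> t t01 /=; rewrite loop_start.
Qed.

Lemma loop_rev_cat (c : loop) :
  homotopic (loop_cat (loop_rev c) c) loop_cst.
Proof.
apply: (@homotopic_reparam c _ _
  (fun t => Num.max (-2 * t + 1) (2 * t + -1)) (fun=> 1)).
- by apply: cont_max; exact: contR_affine.
- exact: cst_continuous.
- by move=> t t01; rewrite maxElt; case: ifPn; rewrite -?leNgt => *; lra.
- by move=> t t01; lra.
- by rewrite maxElt; case: ifPn; rewrite -?leNgt => *; lra.
- by rewrite maxElt; case: ifPn; rewrite -?leNgt => *; lra.
- move=> t t01 /=; rewrite /cat_fun /= maxElt.
  do !case: ifPn; rewrite -?leNgt -?ltNge => *; try (by exfalso; lra); try by [];
    by congr (c _); lra.
- by move=> t t01 /=; rewrite loop_end.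
Qed.

Lemma pi1_mulV : left_inverse pi1_one pi1_inv pi1_mul.
Proof.
move=> u; rewrite -[X in pi1_mul _ X](loop_class_repr u) /pi1_inv pi1_mulE.
exact/loop_classP/loop_rev_cat.
Qed.

Lemma pi1_mulrV : right_inverse pi1_one pi1_inv pi1_mul.
Proof.
move=> u; rewrite -[X in pi1_mul X _](loop_class_repr u) /pi1_inv pi1_mulE.
exact/loop_classP/loop_cat_rev.
Qed.

HB.instance Definition _ := isGroup.Build pi1
  pi1_mulA pi1_mul1 pi1_mulr1 pi1_mulV pi1_mulrV.

End FundamentalGroup.
Arguments loop R {Y} y.
Arguments pi1 R {Y} y.

Section CordAlgebra.
Context {G : groupType} (m l : G).

(* The tensor algebra over Z[lambda^+-1, mu^+-1] modulo the relations is
   presented as a ring: expressions in the generators, modulo the smallest ring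
   congruence making lambda and mu central and invertible and containing the
   relations. *)
Inductive cord_expr : Type :=
| CZero | COne | COpp of cord_expr
| CAdd of cord_expr & cord_expr | CMul of cord_expr & cord_expr
| CLambda | CLambdaInv | CMu | CMuInv | CCord of G.

HB.instance Definition _ := gen_eqMixin cord_expr.
HB.instance Definition _ := gen_choiceMixin cord_expr.

Inductive cord_eq : cord_expr -> cord_expr -> Prop :=
| CRefl a : cord_eq a a
| CSym a b : cord_eq a b -> cord_eq b a
| CTrans a b c : cord_eq a b -> cord_eq b c -> cord_eq a c
| COppCongr a b : cord_eq a b -> cord_eq (COpp a) (COpp b)
| CAddCongr a a' b b' :
    cord_eq a a' -> cord_eq b b' -> cord_eq (CAdd a b) (CAdd a' b')
| CMulCongr a a' b b' :
    cord_eq a a' -> cord_eq b b' -> cord_eq (CMul a b) (CMul a' b')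
| CAddA a b c : cord_eq (CAdd a (CAdd b c)) (CAdd (CAdd a b) c)
| CAddC a b : cord_eq (CAdd a b) (CAdd b a)
| CAdd0 a : cord_eq (CAdd CZero a) a
| CAddN a : cord_eq (CAdd (COpp a) a) CZero
| CMulA a b c : cord_eq (CMul a (CMul b c)) (CMul (CMul a b) c)
| CMul1l a : cord_eq (CMul COne a) a
| CMul1r a : cord_eq (CMul a COne) a
| CMulDl a b c : cord_eq (CMul (CAdd a b) c) (CAdd (CMul a c) (CMul b c))
| CMulDr a b c : cord_eq (CMul a (CAdd b c)) (CAdd (CMul a b) (CMul a c))
| CLambdaC a : cord_eq (CMul CLambda a) (CMul a CLambda)
| CMuC a : cord_eq (CMul CMu a) (CMul a CMu)
| CLambdaV : cord_eq (CMul CLambda CLambdaInv) COne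
| CMuV : cord_eq (CMul CMu CMuInv) COne
| CCord1 : cord_eq (CCord 1%g) (CAdd COne (COpp CMu))
| CCordMr g : cord_eq (CCord (g * m)%g) (CMul CMu (CCord g))
| CCordMl g : cord_eq (CCord (m * g)%g) (CMul CMu (CCord g))
| CCordLr g : cord_eq (CCord (g * l)%g) (CMul CLambda (CCord g))
| CCordLl g : cord_eq (CCord (l * g)%g) (CMul CLambda (CCord g))
| CCordSkein g1 g2 :
    cord_eq (CAdd (CAdd (CCord (g1 * g2)%g) (COpp (CCord (g1 * m * g2)%g)))
                  (COpp (CMul (CCord g1) (CCord g2)))) CZero.

Definition cord_eqb (a b : cord_expr) : bool := `[< cord_eq a b >].

Lemma cord_eqb_refl : reflexive cord_eqb.
Proof. by move=> a; apply/asboolP; exact: CRefl. Qed.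

Lemma cord_eqb_sym : symmetric cord_eqb.
Proof. by move=> a b; apply/asboolP/asboolP; exact: CSym. Qed.

Lemma cord_eqb_trans : transitive cord_eqb.
Proof. by move=> b a c /asboolP ab /asboolP bc; apply/asboolP/(CTrans ab). Qed.

Definition cord_equiv : equiv_rel cord_expr :=
  EquivRel cord_eqb cord_eqb_refl cord_eqb_sym cord_eqb_trans.

Definition cord_algebra := {eq_quot cord_equiv}.
HB.instance Definition _ := Choice.on cord_algebra.

Definition cord_pi (a : cord_expr) : cord_algebra := \pi_cord_algebra a.

Lemma cord_piP (a b : cord_expr) : cord_pi a = cord_pi b <-> cord_eq a b.
Proof.
by split=> [/eqquotP/asboolP//|h]; apply/eqquotP; apply/asboolP.
Qed.

Lemma cord_piK (u : cord_algebra) : cord_pi (repr u) = u.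
Proof. exact: reprK. Qed.

Lemma cord_repr (a : cord_expr) : cord_eq (repr (cord_pi a)) a.
Proof. by apply/cord_piP; rewrite cord_piK. Qed.

Definition cord_opp (u : cord_algebra) := cord_pi (COpp (repr u)).
Definition cord_add (u v : cord_algebra) := cord_pi (CAdd (repr u) (repr v)).
Definition cord_mul (u v : cord_algebra) := cord_pi (CMul (repr u) (repr v)).

Lemma cord_oppE a : cord_opp (cord_pi a) = cord_pi (COpp a).
Proof. by apply/cord_piP/COppCongr/cord_repr. Qed.

Lemma cord_addE a b : cord_add (cord_pi a) (cord_pi b) = cord_pi (CAdd a b).
Proof. by apply/cord_piP/CAddCongr; exact: cord_repr. Qed.

Lemma cord_mulE a b : cord_mul (cord_pi a) (cord_pi b) = cord_pi (CMul a b).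
Proof. by apply/cord_piP/CMulCongr; exact: cord_repr. Qed.

Lemma cord_ind (P : cord_algebra -> Prop) :
  (forall a, P (cord_pi a)) -> forall u, P u.
Proof. by move=> h u; rewrite -(cord_piK u). Qed.

Lemma cord_addA : associative cord_add.
Proof.
elim/cord_ind=> a; elim/cord_ind=> b; elim/cord_ind=> c.
rewrite (cord_addE b c) (cord_addE a b) (cord_addE a) (cord_addE _ c).
exact/cord_piP/CAddA.
Qed.

Lemma cord_addC : commutative cord_add.
Proof.
elim/cord_ind=> a; elim/cord_ind=> b.
by rewrite (cord_addE a b) (cord_addE b a); exact/cord_piP/CAddC.
Qed.

Lemma cord_add0 : left_id (cord_pi CZero) cord_add.
Proof. by elim/cord_ind=> a; rewrite (cord_addE _ a); exact/cord_piP/CAdd0. Qed.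

Lemma cord_addN : left_inverse (cord_pi CZero) cord_opp cord_add.
Proof.
elim/cord_ind=> a; rewrite (cord_oppE a) (cord_addE _ a).
exact/cord_piP/CAddN.
Qed.

HB.instance Definition _ := GRing.isZmodule.Build cord_algebra
  cord_addA cord_addC cord_add0 cord_addN.

Lemma cord_mulA : associative cord_mul.
Proof.
elim/cord_ind=> a; elim/cord_ind=> b; elim/cord_ind=> c.
rewrite (cord_mulE b c) (cord_mulE a b) (cord_mulE a) (cord_mulE _ c).
exact/cord_piP/CMulA.
Qed.

Lemma cord_mul1 : left_id (cord_pi COne) cord_mul.
Proof. by elim/cord_ind=> a; rewrite (cord_mulE _ a); exact/cord_piP/CMul1l. Qed.

Lemma cord_mulr1 : right_id (cord_pi COne) cord_mul.
Proof. by elim/cord_ind=> a; rewrite (cord_mulE a); exact/cord_piP/CMul1r. Qed.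

Lemma cord_mulDl : left_distributive cord_mul +%R.
Proof.
elim/cord_ind=> a; elim/cord_ind=> b; elim/cord_ind=> c.
rewrite [LHS](congr1 (cord_mul^~ _) (cord_addE a b)) (cord_mulE _ c).
rewrite (cord_mulE a c) (cord_mulE b c) [RHS]cord_addE.
exact/cord_piP/CMulDl.
Qed.

Lemma cord_mulDr : right_distributive cord_mul +%R.
Proof.
elim/cord_ind=> a; elim/cord_ind=> b; elim/cord_ind=> c.
rewrite [LHS](congr1 (cord_mul _) (cord_addE b c)) (cord_mulE a).
rewrite (cord_mulE a c) (cord_mulE a b) [RHS]cord_addE.
exact/cord_piP/CMulDr.
Qed.

HB.instance Definition _ := GRing.Zmodule_isPzRing.Build cord_algebra
  cord_mulA cord_mul1 cord_mulr1 cord_mulDl cord_mulDr.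

Definition cord_lambda : cord_algebra := cord_pi CLambda.
Definition cord_mu : cord_algebra := cord_pi CMu.
Definition cord (g : G) : cord_algebra := cord_pi (CCord g).

End CordAlgebra.
Arguments cord_algebra {G} m l.
Arguments cord_lambda {G} m l.
Arguments cord_mu {G} m l.
Arguments cord {G} m l g.

Section Smooth.
Context {R : realType} {V W : normedModType R}.

Fixpoint differentiable_upto (n : nat) (O : set V) (f : V -> W) : Prop :=
  if n is n'.+1 then
    (forall x, O x -> differentiable f x) /\
    (forall v, differentiable_upto n' O ('D_v f))
  else forall x, O x -> {for x, continuous f}.

Definition smooth_on (O : set V) (f : V -> W) : Prop :=
  forall n, differentiable_upto n O f.

End Smooth.

Variant ambient := Euclidean3 | Sphere3.

Section Knot.
Context {R : realType} {a : ambient}.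

Definition ambient_vector : normedModType R :=
  'rV[R]_(if a is Euclidean3 then 2 else 3).+1.

Definition dot (u v : ambient_vector) : R := \sum_i u 0 i * v 0 i.

Definition ambient_space : topologicalType :=
  set_type [set x : ambient_vector | a = Sphere3 -> dot x x = 1].

Definition emb (q : ambient_space) : ambient_vector := set_val q.

Definition tangent (q : ambient_space) (v : ambient_vector) : Prop :=
  a = Sphere3 -> dot (emb q) v = 0.

Definition space_ball (x : ambient_space) (r : R) : set ambient_space :=
  [set y | dot (emb y - emb x) (emb y - emb x) < r ^+ 2].

(* An oriented knot is given by a regular 1-periodic parametrization. *)
Definition oriented_knot (K : R -> ambient_space) : Prop :=
  [/\ smooth_on [set: R] (emb \o K),
      forall t, 'D_1 (emb \o K) t != 0 &
      forall s t, K s = K t <-> exists n : int, s = t + n%:~R].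

Definition knot_complement (K : R -> ambient_space) : topologicalType :=
  set_type (~` range K).

(* tau identifies (R / Z) x D with an open neighbourhood of K, D being the disk
   of radius 2; n(K) is the image of the closed unit disk bundle. No orientation
   is imposed on tau, so both orientations of the meridian are allowed. *)
Definition tubular_neighborhood (K : R -> ambient_space)
    (tau : R * (R * R) -> ambient_space) : Prop :=
  let D := [set p : R * (R * R) | p.2.1 ^+ 2 + p.2.2 ^+ 2 < 2 ^+ 2] in
  [/\ forall t, tau (t, (0, 0)) = K t,
      smooth_on D (emb \o tau),
      forall p v, D p -> 'D_v (emb \o tau) p = 0 -> v = 0,
      forall p q, D p -> D q ->
        (tau p = tau q <-> p.2 = q.2 /\ exists n : int, p.1 = q.1 + n%:~R) &
      forall O, open O -> O `<=` D -> open (tau @` O)].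

Definition unit_circle : set (R * R) := [set p | p.1 ^+ 2 + p.2 ^+ 2 = 1].

Definition tube_boundary (tau : R * (R * R) -> ambient_space) : set ambient_space :=
  tau @` [set p | unit_circle p.2].

Definition meridian (tau : R * (R * R) -> ambient_space) (t0 : R) (p0 : R * R)
    (m : R -> ambient_space) : Prop :=
  forall s, 0 <= s <= 1 -> m s =
    tau (t0, (cos (2 * pi * s) * p0.1 - sin (2 * pi * s) * p0.2,
              sin (2 * pi * s) * p0.1 + cos (2 * pi * s) * p0.2)).

(* Near each of its points S is the zero set of f in {0 <= g}, and K is its
   boundary {f = g = 0}. The continuous field nu, transverse to S and pointing
   to the side where f increases, is the orientation. *)
Definition seifert_surface (K : R -> ambient_space) (S : set ambient_space) :
    Prop :=
  [/\ compact S, connected S, range K `<=` S &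
  exists nu : ambient_space -> ambient_vector,
  [/\ {within S, continuous nu},
      forall q, S q -> tangent q (nu q) &
      forall p, S p -> exists (O : set ambient_vector)
          (f g : ambient_vector -> R),
        [/\ open_nbhs (emb p) O, smooth_on O f, smooth_on O g &
            forall q, O (emb q) ->
            [/\ S q <-> f (emb q) = 0 /\ 0 <= g (emb q),
                range K q <-> f (emb q) = 0 /\ g (emb q) = 0,
                S q -> 0 < 'D_(nu q) f (emb q) &
                range K q -> exists w, [/\ tangent q w,
                  'D_w f (emb q) = 0 & 'D_w g (emb q) != 0]]]]].

(* l parametrizes the intersection of the boundary of n(K) with S; it is
   oriented like K because h winds once in the positive direction. *)
Definition longitude (tau : R * (R * R) -> ambient_space)
    (S : set ambient_space) (t0 : R) (p0 : R * R) (l : R -> ambient_space) :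
    Prop :=
  exists (h : R -> R) (p : R -> R * R),
  [/\ {within `[0, 1], continuous h} /\ {within `[0, 1], continuous p},
      (h 0 = t0 /\ h 1 = t0 + 1) /\ (p 0 = p0 /\ p 1 = p0),
      forall s, 0 <= s <= 1 -> unit_circle (p s) /\ l s = tau (h s, p s),
      forall s s', 0 <= s < 1 -> 0 <= s' < 1 -> l s = l s' -> s = s' &
      l @` `[0, 1] = S `&` tube_boundary tau].

Section KnotSheaf.
Context {k : fieldType} (K : R -> ambient_space) (F : sheaf k ambient_space).

(* Microsupport in the conormal bundle of K away from the zero section, with
   finite rank: F restricts to local systems on the complement and on K. *)
Definition knot_constructible : Prop :=
  pullback_local_system F (set_val : knot_complement K -> ambient_space) /\
  pullback_local_system F (set_val : range K -> ambient_space).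

(* T is the map F_x = F(B) -> F_y; every germ at x extends to B as soon as B is
   small enough, so that T is determined by its values on germs of sections
   over B. *)
Definition restriction_map (B : set ambient_space) (x y : ambient_space)
    (T : {linear stalk F x -> stalk F y}) : Prop :=
  forall s : F B, T (germ F x s) = germ F y s.

Definition simple_sheaf : Prop :=
  forall x, range K x -> exists2 r0 : R, 0 < r0 &
  forall r, 0 < r < r0 ->
  forall y, space_ball x r y -> ~ range K y ->
  exists2 T : {linear stalk F x -> stalk F y},
    restriction_map (space_ball x r) T &
    injective T /\ rank1_cokernel T \/
    (forall v, exists w, T w = v) /\ rank1_kernel T.

Definition rho (b : knot_complement K) (g : pi1 R b) :
    stalk F (set_val b) -> stalk F (set_val b) :=
  @monodromy _ _ F R (fun t => set_val (repr g t)) (set_val b).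

Definition rho_core (t0 : R) : stalk F (K t0) -> stalk F (K t0) :=
  @monodromy _ _ F R (fun t => K (t0 + t)) (K t0).

End KnotSheaf.
End Knot.
Arguments ambient_vector R a : clear implicits.
Arguments ambient_space R a : clear implicits.
Arguments rho {R a k K} F {b} g.
Arguments rho_core {R a k} K F t0.

(* Main.v *)
Require Import Defs.
From HB Require Import structures.
From mathcomp Require Import all_boot all_order all_algebra.
From mathcomp Require Import all_classical all_reals all_analysis.
From mathcomp Require Import lra ring.

Set Implicit Arguments.
Unset Strict Implicit.
Unset Printing Implicit Defensive.

Import Order.TTheory GRing.Theory Num.Theory.
Import numFieldNormedType.Exports.

Local Open Scope classical_set_scope.
Local Open Scope quotient_scope.
Local Open Scope ring_scope.

(** Let V be the stalk at the base point b, W the stalk at the point K t0 of the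
    knot, and T : W -> V the transport of germs along the radius of the tube from
    K t0 to b. Near K t0 a germ of W is a section on a small ball, so T is the
    restriction map of that ball followed by the transport inside the complement
    of the knot, which is an isomorphism; hence T inherits the simplicity of the
    sheaf ([exit_map_simple]).

    Everything follows from three relations: [rho(m) T = T],
    [rho(l) T = T rho'(K)] and [rho(m) rho(l) = rho(l) rho(m)]. The first two
    are one lemma, [tube_loop_monodromy]: a loop on the boundary of the tube is
    shrunk radially onto the knot, which gives a map of the square meeting the
    knot in one edge only, and a section of the sheaf along that square compares
    the transport along the loop with the transport along its shadow on the
    knot. The shadow of the meridian is constant, that of the longitude goes
    once around. The third relation holds because the two loops span a torus in
    the complement ([meridian_longitude_commute]). That sections extend over
    such squares ([rect_liftable], [exit_square_lift]) is the covering property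
    of local systems, plus compactness along the edge lying on the knot.

    The rest is linear algebra ([cord_relations_simple]). If T is injective
    with cokernel spanned by one class, let phi be a nonzero linear form
    vanishing on the image of T. As rho(m) fixes that image, 1 - rho(m) factors
    through phi: it sends v to phi(v) u for a vector u. Then
    epsilon([g]) = phi(rho(g) u), mu = 1 - phi(u), and both u and phi are
    eigenvectors of rho(m) for mu. They are eigenvectors of rho(l) for lambda,
    the eigenvalue of rho(l) on the cokernel, which is the difference of the
    traces of rho(l) and rho'(K). The skein relation is
    phi(rho(g1) (1 - rho(m)) rho(g2) u) = phi(rho(g1) u) phi(rho(g2) u). If T is
    onto with a kernel of rank one, rho(m) is the identity, mu = 1, all cords go
    to 0, and - lambda is the eigenvalue of rho'(K) on the kernel of T. *)

(** * Germs of sections *)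

Section Germs.
Context {k : fieldType} {X : topologicalType} (F : sheaf k X).

Lemma germE x (U : set X) (u : F U) (nU : open_nbhs x U) :
  germ F x u = \pi_(stalk F x) (LocalSection nU u).
Proof.
rewrite /germ; case: pselect => [nU'|/(_ nU)//].
by rewrite (Prop_irrelevance nU nU').
Qed.

Lemma germ_res x (U V : set X) (u : F U) :
  open U -> open_nbhs x V -> V `<=` U -> germ F x (res F V u) = germ F x u.
Proof.
move=> oU nV VU; have nU : open_nbhs x U by split=> //; apply: VU; case: nV.
rewrite (germE _ nV) (germE _ nU); apply: (@stalk_eqW _ _ _ _ _ _ V) => //=.
by rewrite res_comp//; case: nV.
Qed.

Lemma germ_linear x (U : set X) : linear (fun u : F U => germ F x u).
Proof.
move=> a u v; have [nU|nU] := pselect (open_nbhs x U); last first.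
  by rewrite /germ; case: pselect => // _; rewrite scaler0 addr0.
rewrite !(germE _ nU).
have -> : a *: (\pi_(stalk F x) (LocalSection nU u) : stalk F x)
    = \pi_(stalk F x) (LocalSection nU (a *: u)).
  exact: (stalk_scaleE a (LocalSection nU u)).
rewrite [RHS](stalk_addE (LocalSection nU (a *: u)) (LocalSection nU v)).
have [oU _] := nU.
apply: (@stalk_eqW _ _ _ _ _ _ U) => //=.
by rewrite linearD /= !linearD /= !res_comp//; rewrite setIid.
Qed.

Lemma stalk_germ x (v : stalk F x) :
  exists (U : set X) (u : F U), open_nbhs x U /\ germ F x u = v.
Proof.
exists (ls_dom (repr v)), (ls_sec (repr v)); split; first exact: ls_nbhd.
rewrite (germE _ (ls_nbhd _)) -[RHS]reprK; congr (\pi_(stalk F x) _).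
by case: (repr v).
Qed.

(** This is what makes the set where two lifts agree open. *)
Lemma germ_eq_near x (U V : set X) (u : F U) (v : F V) :
  open_nbhs x U -> open_nbhs x V -> germ F x u = germ F x v ->
  exists W, [/\ open_nbhs x W, W `<=` U, W `<=` V &
    forall y, W y -> germ F y u = germ F y v].
Proof.
move=> nU nV; rewrite (germE _ nU) (germE _ nV) => /stalk_eqP/asboolP[W [nW]] /=.
move=> WU WV e; exists W; split=> // y Wy.
have [oW _] := nW; have [oU _] := nU; have [oV _] := nV.
have nWy : open_nbhs y W by [].
by rewrite -(germ_res u oU nWy WU) -(germ_res v oV nWy WV) e.
Qed.

(** The total space of the stalks. Sections along a map are written as maps into
    it, so that stalks at equal points need not be identified by casts. *)
Definition etale := {x : X & stalk F x}.

Definition germ_at (U : set X) (u : F U) (x : X) : etale :=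
  existT _ x (germ F x u).

End Germs.

(** * Continuity on a subset *)

Lemma within_pair (S T U : topologicalType) (A : set S) (f : S -> T)
    (g : S -> U) : {within A, continuous f} -> {within A, continuous g} ->
  {within A, continuous (fun x => (f x, g x))}.
Proof. by move=> cf cg x; exact: (cvg_pair (cf x) (cg x)). Qed.

Lemma within_cst (S T : topologicalType) (A : set S) (c : T) :
  {within A, continuous (fun=> c)}.
Proof. exact/continuous_subspaceT/cst_continuous. Qed.

Lemma within_id (S : topologicalType) (A : set S) : {within A, continuous id}.
Proof. by apply: continuous_subspaceT => ?; exact: cvg_id. Qed.

Lemma within_fst (S T U : topologicalType) (A : set S) (f : S -> T * U) :
  {within A, continuous f} -> {within A, continuous (fun x => (f x).1)}.
Proof. by move=> cf x; apply: (cvg_comp _ _ (cf x)); exact: cvg_fst. Qed.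

Lemma within_snd (S T U : topologicalType) (A : set S) (f : S -> T * U) :
  {within A, continuous f} -> {within A, continuous (fun x => (f x).2)}.
Proof. by move=> cf x; apply: (cvg_comp _ _ (cf x)); exact: cvg_snd. Qed.

Lemma within_mul (R : realType) (S : topologicalType) (A : set S)
    (f g : S -> R) :
  {within A, continuous f} -> {within A, continuous g} ->
  {within A, continuous (fun x => f x * g x)}.
Proof. by move=> cf cg x; exact: (cvgM (cf x) (cg x)). Qed.

Lemma within_add (R : realType) (S : topologicalType) (A : set S)
    (f g : S -> R) :
  {within A, continuous f} -> {within A, continuous g} ->
  {within A, continuous (fun x => f x + g x)}.
Proof. by move=> cf cg x; exact: (cvgD (cf x) (cg x)). Qed.

Lemma within_sub (R : realType) (S : topologicalType) (A : set S)
    (f g : S -> R) :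
  {within A, continuous f} -> {within A, continuous g} ->
  {within A, continuous (fun x => f x - g x)}.
Proof. by move=> cf cg x; exact: (cvgB (cf x) (cg x)). Qed.

(** * Lifts to the space of germs, and local systems *)

Section Lifts.
Context {k : fieldType} {X : topologicalType} (F : sheaf k X).

Lemma within_open_nbhs (Y : topologicalType) (A : set Y) (f : Y -> X) y W :
  {within A, continuous f} -> A y -> open_nbhs (f y) W ->
  \forall y' \near y, A y' -> W (f y').
Proof.
move=> /subspace_continuousP cf Ay nW.
by have := cf y Ay W (open_nbhs_nbhs nW).
Qed.

(** A continuous map to the space of germs over f, in other words a section over
    A of the inverse image of the sheaf along f. *)
Definition is_lift (Y : topologicalType) (A : set Y) (f : Y -> X)
    (s : Y -> etale F) : Prop :=
  forall y, A y -> exists (U : set X) (u : F U), open_nbhs (f y) U /\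
    \forall y' \near y, A y' -> U (f y') /\ s y' = germ_at u (f y').

Context {Y : topologicalType}.
Implicit Types (A B : set Y) (f : Y -> X) (s : Y -> etale F).

Lemma within_self A y (P : Y -> Prop) : A y ->
  (\forall y' \near y, A y' -> P y') -> P y.
Proof. by move=> Ay /nbhs_singleton; exact. Qed.

Lemma lift_tag A f s y : is_lift A f s -> A y -> tag (s y) = f y.
Proof. by move=> ls Ay; have [U [u [_ /(within_self Ay)[_ ->]]]] := ls y Ay. Qed.

Lemma lift_pullback A f (s : forall y, stalk F (f y)) :
  pullback_section A s <-> is_lift A f (fun y => existT _ (f y) (s y)).
Proof.
split=> hs y Ay; have [U [u [nU hu]]] := hs y Ay; exists U, u; split=> //.
  move: hu; rewrite near_withinE; apply: filterS => y' h /h[? e].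
  by split=> //; rewrite /germ_at e.
rewrite near_withinE.
by move: hu; apply: filterS => y' h /h[? e]; split=> //; exact: existT_inj2 e.
Qed.

Lemma lift_sub A B f s : B `<=` A -> is_lift A f s -> is_lift B f s.
Proof.
move=> BA ls y By; have [U [u [nU hu]]] := ls y (BA _ By).
by exists U, u; split=> //; apply: filterS hu => y' h /BA; exact: h.
Qed.

Lemma lift_ext A f f' s s' : (forall y, A y -> f y = f' y) ->
  (forall y, A y -> s y = s' y) -> is_lift A f s -> is_lift A f' s'.
Proof.
move=> ff' ss' ls y Ay; have [U [u [nU hu]]] := ls y Ay.
exists U, u; split; first by rewrite -ff'.
apply: filterS hu => y' h Ay'; have [? ?] := h Ay'.
by rewrite -ff'// -ss'.
Qed.

Lemma lift_comp (Y' : topologicalType) (B : set Y') (g : Y' -> Y) A f s :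
  is_lift A f s -> {within B, continuous g} -> (forall y, B y -> A (g y)) ->
  is_lift B (f \o g) (s \o g).
Proof.
move=> ls /subspace_continuousP cg BA y By; have [U [u [nU hu]]] := ls _ (BA y By).
exists U, u; split=> //.
have := cg y By _ hu; rewrite /= !nbhs_simpl /within /=.
by apply: filterS => y' h By'; exact: h By' (BA _ By').
Qed.

Lemma lift_germ_at A f (U : set X) (u : F U) :
  {within A, continuous f} -> open U -> (forall y, A y -> U (f y)) ->
  is_lift A f (germ_at u \o f).
Proof.
move=> cf oU AU y Ay; exists U, u; split; first by split=> //; exact: AU.
by apply: filterE => y' Ay'; split=> //; exact: AU.
Qed.

(** At a common point the two inducing sections of the sheaf have the same germ,
    hence agree nearby, so that either of them induces the lift on both sides. *)
Lemma lift_paste A B f s : closed A -> closed B ->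
  {within A `|` B, continuous f} ->
  is_lift A f s -> is_lift B f s -> is_lift (A `|` B) f s.
Proof.
suff side A' B' : closed B' -> {within A' `|` B', continuous f} ->
    is_lift A' f s -> is_lift B' f s -> forall y, A' y ->
    exists (U : set X) (u : F U), open_nbhs (f y) U /\
    \forall y' \near y, (A' `|` B') y' -> U (f y') /\
      s y' = germ_at u (f y').
  move=> cA cB cf lA lB y [Ay|By]; first exact: side.
  by rewrite setUC; apply: side => //; rewrite setUC.
move=> cB cf lA lB y Ay; have [U [u [nU hu]]] := lA y Ay.
have [By|nBy] := pselect (B' y); last first.
  exists U, u; split=> //.
  have nB : nbhs y (~` B').
    by apply: open_nbhs_nbhs; split=> //; exact: closed_openC.
  by apply: filterS2 nB hu => y' nBy' h [/h//|/nBy'].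
have [V [v [nV hv]]] := lB y By.
have e : germ F (f y) u = germ F (f y) v.
  have [_ eu] := within_self Ay hu; have [_ ev] := within_self By hv.
  by apply: existT_inj2; rewrite -[LHS]eu -[RHS]ev.
have [W [nW WU WV uv]] := germ_eq_near nU nV e.
exists U, u; split=> //.
have hW := within_open_nbhs cf (or_introl Ay) nW.
apply: filterS3 hW hu hv => y' hW hu hv AB; have Wy' := hW AB.
split; first exact: WU.
by case: AB => [/hu[]//|/hv[_ ->]]; rewrite /germ_at uv.
Qed.

(** What lifting uses of a local system: the first clause gives local lifts
    through every germ, the second makes the locus where two lifts agree closed.
    Both speak of points of Z only, so that Z can be the knot as well as its
    complement. *)
Definition evenly_covered (Z : set X) : Prop :=
  (forall q, Z q -> exists O, open_nbhs q O /\
     forall g : etale F, (O `&` Z) (tag g) ->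
     exists s : X -> etale F, is_lift (O `&` Z) id s /\ s (tag g) = g) /\
  (forall q (U V : set X) (u : F U) (v : F V), Z q ->
     open_nbhs q U -> open_nbhs q V -> germ F q u <> germ F q v ->
     exists W, open_nbhs q W /\
       forall x, W x -> Z x -> germ F x u <> germ F x v).

End Lifts.

Section LocalSystem.
Context {k : fieldType} {X : topologicalType} (F : sheaf k X) (Z : set X).

Lemma set_val_nbhs (z : set_type Z) (P : set (set_type Z)) : nbhs z P ->
  exists O, open_nbhs (set_val z) O /\ forall z', O (set_val z') -> P z'.
Proof.
rewrite nbhsE => -[Q [ [C oC CQ] Qz] QP].
exists C; split; first by split=> //; move: Qz; rewrite -CQ.
by move=> z' Cz; apply: QP; rewrite -CQ.
Qed.

Lemma set_val_cont : continuous (set_val : set_type Z -> X).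
Proof. exact: initial_continuous. Qed.

(** In a trivialization the sections are the families of germs with locally
    constant coordinates. So the germs with the same coordinates as a given one
    form a section, and two sections with different coordinates at a point keep
    different coordinates around it. *)
Lemma local_system_evenly_covered :
  pullback_local_system F (set_val : set_type Z -> X) -> evenly_covered F Z.
Proof.
move=> ls; split.
  move=> q Zq; have [V [n [phi [nV bij flat]]]] := ls (exist _ q (mem_set Zq)).
  have [N [nO OV]] := set_val_nbhs (open_nbhs_nbhs nV).
  exists N; split=> // -[x v] /= [Ox Zx].
  pose zx : set_type Z := exist _ x (mem_set Zx).
  pose c := phi zx v.
  have [oV _] := nV.
  have bijV y : V y -> exists w, phi y w = c.
    by move=> /bij[psi _ cK]; exists (psi c); rewrite cK.
  pose t y : stalk F (set_val y) := xget 0 [set w | phi y w = c].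
  have tE y : V y -> phi y (t y) = c.
    by move=> /bijV[w hw]; rewrite /t; case: xgetP => [w' _ //|/(_ w)].
  have lt : is_lift V set_val (fun y => existT (stalk F) (set_val y) (t y)).
    apply/lift_pullback/(flat V t oV (@subset_refl _ V)) => y Vy.
    have : nbhs y V by apply: open_nbhs_nbhs.
    by apply: filterS => y' Vy'; rewrite !tE.
  pose s x' : etale F := if pselect (Z x') is left zx'
    then existT _ x' (t (exist _ x' (mem_set zx'))) else existT (stalk F) x' (0 : stalk F x').
  have sE z : s (set_val z) = existT _ (set_val z) (t z).
    case: z => x' zx'; rewrite /s /=; case: pselect => [zx2|]; last first.
      by case; exact: set_mem.
    by rewrite (Prop_irrelevance (mem_set zx2) zx').
  exists s; split.
    move=> x' [Ox' Zx']; pose z' : set_type Z := exist _ x' (mem_set Zx').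
    have [U [u [nU hu]]] := lt z' (OV z' Ox'); exists U, u; split=> //.
    have [N' [ [oO' N'x'] hO']] := set_val_nbhs hu.
    have : nbhs x' N' by apply: open_nbhs_nbhs.
    apply: filterS => y N'y [Oy Zy]; pose zy : set_type Z := exist _ y (mem_set Zy).
    have := hO' zy N'y (OV zy Oy) => -[? e]; split=> //.
    by rewrite -[RHS]e -sE.
  rewrite -[x]/(set_val zx) sE; congr existT.
  have Vx : V zx by exact: OV.
  by have /bij_inj := bij _ Vx; apply; exact: tE.
move=> q U V u v Zq nU nV neq.
pose zq : set_type Z := exist _ q (mem_set Zq).
have [C [n [phi [nC bij flat]]]] := ls zq.
have nI : open_nbhs q (U `&` V) by exact: open_nbhs_setI.
pose D := C `&` (set_val @^-1` (U `&` V)).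
have oD : open D.
  apply: openI; first by case: nC.
  by apply: open_comp; [move=> ? _; exact: set_val_cont|case: nI].
have Dq : D zq by split; [case: nC|case: nI].
have locconst (U' : set X) (u' : F U') : open U' ->
    (forall y, D y -> U' (set_val y)) ->
    \forall z \near zq, phi z (germ F (set_val z) u') = phi zq (germ F q u').
  move=> oU' DU'.
  suff /(flat D (fun z => germ F (set_val z) u')) : pullback_section D
      (fun z : set_type Z => germ F (set_val z) u').
    by move=> h; exact: (h oD (@subIsetl _ _ _) zq Dq).
  apply/lift_pullback.
  apply: (@lift_germ_at _ _ _ _ D set_val U' u') => //.
  exact/continuous_subspaceT/set_val_cont.
have hu := locconst U u (proj1 nU) (fun y Dy => proj1 (proj2 Dy)).
have hv := locconst V v (proj1 nV) (fun y Dy => proj2 (proj2 Dy)).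
have [W [nW hW]] := set_val_nbhs (filterI hu hv).
exists W; split=> // x Wx Zx e.
pose zx : set_type Z := exist _ x (mem_set Zx).
have [/= eu ev] := hW zx Wx.
apply: neq; have /bij_inj := bij zq (proj1 Dq); apply.
by rewrite -[LHS]eu -[RHS]ev /= e.
Qed.

End LocalSystem.

(** * Uniqueness and existence of lifts *)

Section Uniqueness.
Context {k : fieldType} {X Y : topologicalType} (F : sheaf k X).
Implicit Types (A B : set Y) (f : Y -> X) (s : Y -> etale F).

Lemma lift_eq_near A f s s' y : {within A, continuous f} ->
  is_lift A f s -> is_lift A f s' -> A y -> s y = s' y ->
  \forall y' \near y, A y' -> s y' = s' y'.
Proof.
move=> cf ls ls' Ay e.
have [U [u [nU hu]]] := ls y Ay; have [V [v [nV hv]]] := ls' y Ay.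
have e' : germ F (f y) u = germ F (f y) v.
  have [_ eu] := within_self Ay hu; have [_ ev] := within_self Ay hv.
  by apply: existT_inj2; rewrite -[LHS]eu -[RHS]ev.
have [W [nW WU WV uv]] := germ_eq_near nU nV e'.
apply: filterS3 (within_open_nbhs cf Ay nW) hu hv => y' hW hu hv Ay'.
by have [_ ->] := hu Ay'; have [_ ->] := hv Ay'; rewrite /germ_at uv//; exact: hW.
Qed.

Lemma lift_neq_near Z A f s s' y : evenly_covered F Z ->
  {within A, continuous f} -> is_lift A f s -> is_lift A f s' -> A y ->
  s y <> s' y -> (\forall y' \near y, A y' -> Z (f y')) ->
  \forall y' \near y, A y' -> s y' <> s' y'.
Proof.
move=> [_ sep] cf ls ls' Ay ne hZ.
have [U [u [nU hu]]] := ls y Ay; have [V [v [nV hv]]] := ls' y Ay.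
have ne' : germ F (f y) u <> germ F (f y) v.
  have [_ eu] := within_self Ay hu; have [_ ev] := within_self Ay hv.
  by move=> e; apply: ne; rewrite eu ev /germ_at e.
have [W [nW uv]] := sep _ _ _ _ _ (within_self Ay hZ) nU nV ne'.
have hW := within_open_nbhs cf Ay nW.
apply: filterS2 (filterI hu hv) (filterI hW hZ) => y' [hu' hv'] [hW' hZ'] Ay'.
have [_ ->] := hu' Ay'; have [_ ->] := hv' Ay'.
by move=> e; apply: (uv (f y') (hW' Ay') (hZ' Ay')); exact: existT_inj2 e.
Qed.

(** The set where two lifts agree is open, and it is closed at the points of the
    map in Z. The last hypothesis allows the map to leave Z where the lifts
    already agree: this is how a lift is continued away from the knot. *)
Lemma lift_unique Z A f s s' y0 : evenly_covered F Z -> connected A ->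
  {within A, continuous f} -> is_lift A f s -> is_lift A f s' ->
  A y0 -> s y0 = s' y0 ->
  (forall y, A y -> s y <> s' y -> \forall y' \near y, A y' -> Z (f y')) ->
  forall y, A y -> s y = s' y.
Proof.
move=> evZ cA cf ls ls' Ay0 e0 hZ.
suff <- : A `&` [set y | s y = s' y] = A by move=> y [].
apply: cA; first by exists y0.
- exists [set y | A y -> s y = s' y]^°; first exact: open_interior.
  apply/seteqP; split=> y /= [Ay].
    by move=> e; split=> //; exact: lift_eq_near e.
  by move=> /nbhs_singleton /(_ Ay).
- exists (~` [set y | A y -> s y <> s' y]^°).
    exact/open_closedC/open_interior.
  apply/seteqP; split=> y /= [Ay].
    by move=> e; split=> // /nbhs_singleton /(_ Ay).
  move=> h; split=> //; apply: contrapT => ne; apply: h.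
  by apply: (lift_neq_near evZ cf) => //; exact: hZ.
Qed.

Lemma lift_glue A B f s s' : closed A -> closed B ->
  {within A `|` B, continuous f} -> is_lift A f s -> is_lift B f s' ->
  (forall y, A y -> B y -> s y = s' y) ->
  exists t, [/\ is_lift (A `|` B) f t, forall y, A y -> t y = s y &
    forall y, B y -> t y = s' y].
Proof.
move=> cA cB cf ls ls' e.
pose t y := if pselect (A y) is left _ then s y else s' y.
have tA y : A y -> t y = s y by rewrite /t; case: pselect.
have tB y : B y -> t y = s' y.
  by rewrite /t; case: pselect => // Ay By; exact: e.
exists t; split=> //; apply: lift_paste => //.
  by apply: lift_ext ls => // y /tA.
by apply: lift_ext ls' => // y /tB.
Qed.

(** Quantifying over all starting germs is what makes the property pass to
    unions with connected intersection. *)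
Definition liftable A f : Prop :=
  forall y (g : etale F), A y -> tag g = f y ->
  exists s, is_lift A f s /\ s y = g.

Lemma liftable_union Z A B f : evenly_covered F Z -> closed A -> closed B ->
  {within A `|` B, continuous f} -> (forall y, (A `|` B) y -> Z (f y)) ->
  connected (A `&` B) -> A `&` B !=set0 ->
  liftable A f -> liftable B f -> liftable (A `|` B) f.
Proof.
suff side A' B' : evenly_covered F Z -> closed A' -> closed B' ->
    {within A' `|` B', continuous f} -> (forall y, (A' `|` B') y -> Z (f y)) ->
    connected (A' `&` B') -> A' `&` B' !=set0 ->
    liftable A' f -> liftable B' f ->
    forall y g, A' y -> tag g = f y -> exists s, is_lift (A' `|` B') f s /\ s y = g.
  move=> evZ cA cB cf fZ cAB nAB lA lB y g [Ay|By]; first exact: side.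
  by rewrite setUC; apply: side; rewrite // 1?setUC// setIC.
move=> evZ cA cB cf fZ cAB [y1 [Ay1 By1]] lA lB y g Ay gy.
have [s [ls sy]] := lA y g Ay gy.
have [s' [ls' s'y]] := lB y1 (s y1) By1 (lift_tag ls Ay1).
have AI : A' `&` B' `<=` A' by move=> ? [].
have BI : A' `&` B' `<=` B' by move=> ? [].
have [t [lt tA _]] : exists t, [/\ is_lift (A' `|` B') f t,
    forall y, A' y -> t y = s y & forall y, B' y -> t y = s' y].
  apply: lift_glue => // z Az Bz.
  apply: (lift_unique evZ cAB _ (lift_sub AI ls) (lift_sub BI ls') (y0 := y1)) => //.
    by apply: continuous_subspaceW cf => ? /AI; left.
  by move=> w [Aw _] _; apply: filterE => w' [Aw' _]; apply: fZ; left.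
by exists t; split=> //; rewrite tA.
Qed.

End Uniqueness.

Section Squares.
Context {R : realType}.

(** Compactness of a segment as an induction principle (Cousin's lemma). The
    supremum z of the x with P a x is reached, and passed unless z = b, by a
    small segment around z. *)
Lemma segment_cousin (a b : R) (P : R -> R -> Prop) : a <= b ->
  (forall x, a <= x <= b -> exists2 e, 0 < e &
     forall c d, a <= c -> c <= x -> x <= d -> d <= b ->
       x - e < c -> d < x + e -> P c d) ->
  (forall c d e, a <= c -> c <= d -> d <= e -> e <= b ->
     P c d -> P d e -> P c e) ->
  P a b.
Proof.
move=> ab loc add.
pose S := [set x | a <= x <= b /\ P a x].
have Sa : S a.
  split; first by rewrite lexx.
  have [|e e0 h] := loc a; first by rewrite lexx.
  by apply: h => //; lra.
have supS : has_sup S by split; [exists a|exists b => x [/andP[]]].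
pose z := sup S.
have az : a <= z by exact: (sup_upper_bound supS).
have zb : z <= b by apply: sup_le_ub; [exists a|move=> x [/andP[]]].
have [|e e0 h] := loc z; first by rewrite az.
have [x Sx zex] := sup_adherent e0 supS.
have xz : x <= z by exact: (sup_upper_bound supS).
have [/andP[ax xb] Pax] := Sx.
pose d := Num.min b (z + e / 2).
have zd : z <= d by rewrite /d le_min zb; lra.
have db : d <= b by rewrite /d ge_min lexx.
have dz : d < z + e by rewrite /d gt_min; apply/orP; right; lra.
have Pad : P a d by apply: (add a x d) => //; [lra|exact: h].
have : d <= z by apply: (sup_upper_bound supS); split=> //; rewrite db; lra.
rewrite {1}/d ge_min => /orP[bz|]; last lra.
by rewrite (_ : b = d)//; apply/eqP; rewrite eq_le db andbT; lra.
Qed.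

Definition rect (a b c d : R) : set (R * R) := `[a, b] `*` `[c, d].

Lemma rectP a b c d s t : rect a b c d (s, t) <-> a <= s <= b /\ c <= t <= d.
Proof. by rewrite /rect /= !in_itv. Qed.

Lemma closed_rect a b c d : closed (rect a b c d).
Proof.
have -> : rect a b c d = (fst @^-1` `[a, b]) `&` (snd @^-1` `[c, d]) by [].
by apply: closedI; apply: preimage_closed => [? _|];
  [exact: cvg_fst|exact: itv_closed|exact: cvg_snd|exact: itv_closed].
Qed.

Lemma connected_rect_vertical b c d : connected (rect b b c d).
Proof.
have -> : rect b b c d = (fun t => (b, t)) @` `[c, d].
  apply/seteqP; split=> [[s t] /rectP[sb tcd]|[s t] [u /= ucd [<- <-]]].
    by exists t; [rewrite /= in_itv|congr pair; lra].
  by apply/rectP; split; [lra|move: ucd; rewrite in_itv].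
apply: connected_continuous_connected; first exact: segment_connected.
by apply: within_pair; [exact: within_cst|exact: within_id].
Qed.

Lemma connected_rect_horizontal a b c : connected (rect a b c c).
Proof.
have -> : rect a b c c = (fun s => (s, c)) @` `[a, b].
  apply/seteqP; split=> [[s t] /rectP[sb tcd]|[s t] [u /= ucd [<- <-]]].
    by exists s; [rewrite /= in_itv|congr pair; lra].
  by apply/rectP; split; [move: ucd; rewrite in_itv|lra].
apply: connected_continuous_connected; first exact: segment_connected.
by apply: within_pair; [exact: within_id|exact: within_cst].
Qed.

Lemma rectU_vertical a b e c d : a <= b -> b <= e ->
  rect a b c d `|` rect b e c d = rect a e c d.
Proof.
move=> ab be; apply/seteqP; split=> [[s t] [|] /rectP[? ?]|[s t] /rectP[? ?]].
- by apply/rectP; split=> //; lra.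
- by apply/rectP; split=> //; lra.
- by have [?|?] := leP s b; [left|right]; apply/rectP; split=> //; lra.
Qed.

Lemma rectU_horizontal a b c d e : c <= d -> d <= e ->
  rect a b c d `|` rect a b d e = rect a b c e.
Proof.
move=> ab be; apply/seteqP; split=> [[s t] [|] /rectP[? ?]|[s t] /rectP[? ?]].
- by apply/rectP; split=> //; lra.
- by apply/rectP; split=> //; lra.
- by have [?|?] := leP t d; [left|right]; apply/rectP; split=> //; lra.
Qed.

Lemma rectI_vertical a b e c d : a <= b -> b <= e ->
  rect a b c d `&` rect b e c d = rect b b c d.
Proof.
move=> ab be; apply/seteqP; split=> [[s t] [/rectP[? ?] /rectP[? ?]]|[s t] /rectP[? ?]].
  by apply/rectP; split=> //; lra.
by split; apply/rectP; split=> //; lra.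
Qed.

Lemma rectI_horizontal a b c d e : c <= d -> d <= e ->
  rect a b c d `&` rect a b d e = rect a b d d.
Proof.
move=> ab be; apply/seteqP; split=> [[s t] [/rectP[? ?] /rectP[? ?]]|[s t] /rectP[? ?]].
  by apply/rectP; split=> //; lra.
by split; apply/rectP; split=> //; lra.
Qed.

Lemma rect_sub a b c d a' b' c' d' : a <= a' -> b' <= b -> c <= c' -> d' <= d ->
  rect a' b' c' d' `<=` rect a b c d.
Proof. by move=> ? ? ? ? [s t] /rectP[? ?]; apply/rectP; split; lra. Qed.

Lemma near_rect (P : R * R -> Prop) s t : (\forall p \near (s, t), P p) ->
  exists2 e, 0 < e & forall s' t', s - e < s' -> s' < s + e ->
    t - e < t' -> t' < t + e -> P (s', t').
Proof.
move=> /nbhs_ballP[e /= e0 h]; exists e => // s' t' ? ? ? ?; apply: h.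
by split; rewrite /ball /= ltr_distl; lra.
Qed.

Context {k : fieldType} {X : topologicalType} (F : sheaf k X).
Implicit Types f : R * R -> X.

(** Small rectangles lift by a single flat section. Cousin's lemma is applied to
    the first coordinate in a thin strip around each height, where a positive
    thickness survives unions, and then to the second coordinate. *)
Lemma rect_liftable Z a b c d f : a <= b -> c <= d -> evenly_covered F Z ->
  {within rect a b c d, continuous f} ->
  (forall p, rect a b c d p -> Z (f p)) -> liftable F (rect a b c d) f.
Proof.
move=> ab cd evZ cf fZ.
have sub a' b' c' d' : a <= a' -> b' <= b -> c <= c' -> d' <= d ->
    {within rect a' b' c' d', continuous f} /\
    forall p, rect a' b' c' d' p -> Z (f p).
  move=> ha hb hc hd; have hr := rect_sub ha hb hc hd; split.
    exact: continuous_subspaceW cf.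
  by move=> p /hr; exact: fZ.
apply: (segment_cousin (P := fun c' d' => liftable F (rect a b c' d') f) cd).
- move=> t tcd.
  apply: (segment_cousin (P := fun a' b' => exists2 e, 0 < e & forall c' d',
    c <= c' -> c' <= t -> t <= d' -> d' <= d -> t - e < c' -> d' < t + e ->
    liftable F (rect a' b' c' d') f) ab).
  + move=> s sab; have rst : rect a b c d (s, t) by apply/rectP.
    have [N [nN flat]] := evZ.1 _ (fZ _ rst).
    have [e e0 he] := near_rect (within_open_nbhs cf rst nN).
    exists e => // a' b' aa as_ sb bb ea eb; exists e => // c' d' cc ct td dd ec ed.
    have hr := rect_sub aa bb cc dd; have [cf' fZ'] := sub _ _ _ _ aa bb cc dd.
    have rN p : rect a' b' c' d' p -> (N `&` Z) (f p).
      move=> rp; split; last exact: fZ'.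
      case: p rp => s' t' rp; apply: he (hr _ rp); move/rectP: rp; lra.
    move=> p g rp gp; have [|u [lu ug]] := flat g; first by rewrite gp; exact: rN.
    exists (u \o f); split; first exact: (lift_comp lu cf' rN).
    by rewrite /= -gp.
  + move=> a1 b1 a2 aa ab1 ba bb [e1 e10 h1] [e2 e20 h2].
    exists (Num.min e1 e2); first by rewrite lt_min e10.
    move=> c' d' cc ct td dd ec ed.
    have m1 : Num.min e1 e2 <= e1 by rewrite ge_min lexx.
    have m2 : Num.min e1 e2 <= e2 by rewrite ge_min lexx orbT.
    rewrite -(rectU_vertical _ _ ab1 ba).
    have [cf' fZ'] := sub _ _ _ _ aa bb cc dd.
    apply: (liftable_union evZ); rewrite ?rectU_vertical ?rectI_vertical//.
    * exact: closed_rect.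
    * exact: closed_rect.
    * exact: connected_rect_vertical.
    * by exists (b1, t); apply/rectP; lra.
    * by apply: h1 => //; lra.
    * by apply: h2 => //; lra.
- move=> c1 d1 c2 cc cd1 dc dd h1 h2.
  rewrite -(rectU_horizontal _ _ cd1 dc).
  have [cf' fZ'] := sub _ _ _ _ (lexx a) (lexx b) cc dd.
  apply: (liftable_union evZ); rewrite ?rectU_horizontal ?rectI_horizontal//.
  + exact: closed_rect.
  + exact: closed_rect.
  + exact: connected_rect_horizontal.
  + by exists (a, d1); apply/rectP; lra.
Qed.

Lemma path_liftable Z (c : R -> X) : evenly_covered F Z ->
  {within `[0, 1], continuous c} -> (forall t, 0 <= t <= 1 -> Z (c t)) ->
  liftable F (`[0, 1]%classic : set R) c.
Proof.
move=> evZ cc cZ t g /unit_intervalP t01 gt.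
have fR p : rect 0 1 0 1 p -> `[0, 1]%classic p.1 by case.
have cf : {within rect 0 1 0 1, continuous (c \o fst)}.
  apply: within_comp cc fR.
  by apply: continuous_subspaceT => ?; exact: cvg_fst.
have lf : liftable F (rect 0 1 0 1) (c \o fst).
  apply: (rect_liftable _ _ evZ cf) => // p /fR/unit_intervalP; exact: cZ.
have [|s [ls st]] := lf (t, 0) g _ gt; first by apply/rectP; split=> //; lra.
exists (s \o (fun t => (t, 0))); split=> //.
apply: (@lift_comp _ _ F _ _ _ (fun t => (t, 0)) _ _ _ ls).
  by apply: within_pair; [exact: within_id|exact: within_cst].
by move=> u /unit_intervalP u01; apply/rectP; split=> //; lra.
Qed.

End Squares.

(** * Lifting squares with an edge on the knot *)

Section ExitSquare.
Context {R : realType} {k : fieldType} {X : topologicalType} (F : sheaf k X).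
Implicit Types f : R * R -> X.

(** Only the end (b, d) of the vertical segment may lie off Z, and there the
    lifts agree by assumption, so they agree on the whole segment. *)
Lemma rect_edges_agree Z f (b c d : R) (s s' : R * R -> etale F) : evenly_covered F Z ->
  {within rect b b c d, continuous f} ->
  (forall t, c <= t < d -> Z (f (b, t))) ->
  is_lift (rect b b c d) f s -> is_lift (rect b b c d) f s' ->
  s (b, d) = s' (b, d) -> forall t, c <= t <= d -> s (b, t) = s' (b, t).
Proof.
move=> evZ cf fZ ls ls' e t tcd.
have rbd : rect b b c d (b, d) by apply/rectP; split=> //; lra.
apply: (lift_unique evZ _ cf ls ls' rbd e); last by apply/rectP; split=> //; lra.
  exact: connected_rect_vertical.
move=> [b' t'] /rectP[bb' tcd'] ne.
have {bb'}eb : b' = b by lra.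
subst b'.
have t'd : t' < d.
  by rewrite lt_neqAle; apply/andP; split; [apply/eqP => ed; apply: ne; rewrite ed|lra].
have : nbhs (b, t') [set p | p.2 < d].
  have := @cvg_snd _ _ (nbhs b) (nbhs t') _ [set u | u < d]; apply.
  by exact: lt_nbhsl.
apply: filterS => -[b1 t1] /= t1d /rectP[bb1 tcd1].
by rewrite (_ : b1 = b); [apply: fZ; lra|lra].
Qed.

(** The sections of the sheaf that induce the given section along the top edge
    live on open sets of X, so each of them also covers a small square below the
    edge; compactness of the edge gives a collar of positive height. *)
Lemma collar_lift Z f (beta : R -> etale F) : evenly_covered F Z ->
  {within unit_square, continuous f} ->
  (forall s t, 0 <= s <= 1 -> 0 <= t < 1 -> Z (f (s, t))) ->
  is_lift (`[0, 1]%classic : set R) (fun s => f (s, 1)) beta ->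
  exists e, 0 < e <= 1 /\ exists s : R * R -> etale F, is_lift (rect 0 1 (1 - e) 1) f s /\
    forall x, 0 <= x <= 1 -> s (x, 1) = beta x.
Proof.
move=> evZ cf fZ lb.
have cfr a b e : 0 <= a -> b <= 1 -> e <= 1 ->
    {within rect a b (1 - e) 1, continuous f}.
  move=> a0 b1 e1; apply: continuous_subspaceW cf; apply: rect_sub => //; lra.
apply: (segment_cousin (P := fun a b => exists e, 0 < e <= 1 /\
  exists s : R * R -> etale F, is_lift (rect a b (1 - e) 1) f s /\
    forall x, a <= x <= b -> s (x, 1) = beta x)) => //.
- move=> x x01.
  have [U [u [nU hu]]] := lb x (proj2 (unit_intervalP x) x01).
  have rx : unit_square (x, 1) by apply/rectP; split=> //; lra.
  have hu2 : \forall p \near ((x, 1) : R * R), `[0, 1]%classic p.1 ->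
      U (f (p.1, 1)) /\ beta p.1 = germ_at u (f (p.1, 1)).
    exact: (@cvg_fst _ _ (nbhs x) (nbhs (1 : R)) _ _ hu).
  have [e e0 he] := near_rect (filterI (within_open_nbhs cf rx nU) hu2).
  exists e => // a b a0 ax xb b1 ea eb.
  pose d := Num.min 1 (e / 2).
  have d1 : d <= 1 by rewrite /d ge_min lexx.
  have de : d <= e / 2 by rewrite /d ge_min lexx orbT.
  have d0 : 0 < d by rewrite /d lt_min; lra.
  exists d; split; first by rewrite d0.
  exists (germ_at u \o f); split.
    apply: lift_germ_at; [exact: cfr|by case: nU|].
    move=> [x' t'] /rectP[? ?]; have [||||h _] := he x' t'; [lra|lra|lra|lra|].
    by apply: h; apply/rectP; split; lra.
  move=> x' x'ab; have [||||_ /= h] := he x' 1; [lra|lra|lra|lra|].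
  have /h[_ ->] // : `[0, 1]%classic x' by apply/unit_intervalP; lra.
- move=> a b c a0 ab bc c1 [e1 [e10 [s1 [ls1 s1b]]]] [e2 [e20 [s2 [ls2 s2b]]]].
  pose e := Num.min e1 e2.
  have ee1 : e <= e1 by rewrite /e ge_min lexx.
  have ee2 : e <= e2 by rewrite /e ge_min lexx orbT.
  have e0 : 0 < e by rewrite /e lt_min; lra.
  exists e; split; first by lra.
  rewrite -(rectU_vertical _ _ ab bc).
  have ls1' : is_lift (rect a b (1 - e) 1) f s1.
    by apply: lift_sub ls1; apply: rect_sub => //; lra.
  have ls2' : is_lift (rect b c (1 - e) 1) f s2.
    by apply: lift_sub ls2; apply: rect_sub => //; lra.
  have [||||s [ls sE1 sE2]] := lift_glue _ _ _ ls1' ls2'.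
  + exact: closed_rect.
  + exact: closed_rect.
  + by rewrite rectU_vertical//; apply: cfr; lra.
  + move=> [b' t] /rectP[h1 h2] /rectP[h3 h4].
    have {h1 h3}eb : b' = b by lra.
    subst b'; apply: (@rect_edges_agree Z f b (1 - e) 1) => //.
    * by apply: cfr; lra.
    * by move=> t' t'e; apply: fZ; lra.
    * by apply: lift_sub ls1'; apply: rect_sub => //; lra.
    * by apply: lift_sub ls2'; apply: rect_sub => //; lra.
    * by rewrite s1b ?s2b//; lra.
  exists s; split=> // x xac; have [xb|/ltW bx] := leP x b.
    by rewrite sE1 ?s1b//; [lra|apply/rectP; lra].
  by rewrite sE2 ?s2b//; [lra|apply/rectP; lra].
Qed.

(** A square that meets the stratum Z' in its top edge only lifts from any germ
    over a point of that edge: lift the edge along Z', thicken it to a collar,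
    and continue through Z. *)
Lemma exit_square_lift Z Z' f x (g : etale F) :
  evenly_covered F Z -> evenly_covered F Z' ->
  {within unit_square, continuous f} ->
  (forall s t, 0 <= s <= 1 -> 0 <= t < 1 -> Z (f (s, t))) ->
  (forall s, 0 <= s <= 1 -> Z' (f (s, 1))) ->
  0 <= x <= 1 -> tag g = f (x, 1) ->
  exists s : R * R -> etale F, is_lift unit_square f s /\ s (x, 1) = g.
Proof.
move=> evZ evZ' cf fZ fZ' x01 gx.
have cedge : {within `[0, 1], continuous (fun s => f (s, 1))}.
  have ci : {within `[0, 1], continuous (fun s : R => (s, 1 : R))}.
    by apply: within_pair; [exact: within_id|exact: within_cst].
  apply: (within_comp ci cf) => s /unit_intervalP ?.
  by apply/rectP; split=> //; lra.
have [beta [lb bx]] := path_liftable evZ' cedge fZ' (proj2 (unit_intervalP x) x01) gx.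
have [e [e01 [s1 [ls1 s1b]]]] := collar_lift evZ cf fZ lb.
have p0 : rect 0 1 (1 - e) 1 (0, 1 - e) by apply/rectP; lra.
have sq : rect 0 1 0 (1 - e) `|` rect 0 1 (1 - e) 1 = rect 0 1 0 1.
  by rewrite rectU_horizontal//; lra.
have cf2 : {within rect 0 1 0 (1 - e), continuous f}.
  by apply: continuous_subspaceW cf; rewrite -[unit_square]sq => ?; left.
have fZ2 p : rect 0 1 0 (1 - e) p -> Z (f p).
  by case: p => s t /rectP[? ?]; apply: fZ => //; lra.
have lf : liftable F (rect 0 1 0 (1 - e)) f.
  by apply: (rect_liftable _ _ evZ cf2 fZ2) => //; lra.
have [|s2 [ls2 s20]] := lf (0, 1 - e) (s1 (0, 1 - e)) _ (lift_tag ls1 p0).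
  by apply/rectP; lra.
have [||||s [ls sE1 sE2]] := lift_glue _ _ _ ls2 ls1.
- exact: closed_rect.
- exact: closed_rect.
- by rewrite sq.
- have sub1 : rect 0 1 (1 - e) (1 - e) `<=` rect 0 1 0 (1 - e).
    by apply: rect_sub => //; lra.
  have sub2 : rect 0 1 (1 - e) (1 - e) `<=` rect 0 1 (1 - e) 1.
    by apply: rect_sub => //; lra.
  move=> y y1 y2; apply: (lift_unique evZ _ _ (lift_sub sub1 ls2)
    (lift_sub sub2 ls1) (y0 := (0, 1 - e))) => //.
  + exact: connected_rect_horizontal.
  + exact: continuous_subspaceW cf2.
  + by apply/rectP; lra.
  + by move=> z _ _; apply: filterE => z' /sub1/fZ2.
  + by case: y y1 y2 => ? ? /rectP[? ?] /rectP[? ?]; apply/rectP; split=> //; lra.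
rewrite [rect _ _ _ _ `|` _]sq in ls.
exists s; split=> //; rewrite sE2 ?s1b//; apply/rectP; split=> //; lra.
Qed.

End ExitSquare.

(** * Transport along a path *)

Section Transport.
Context {R : realType} {k : fieldType} {X : topologicalType} (F : sheaf k X).
Implicit Types (c d : R -> X) (g h : etale F).

(** Transport runs from time 1 to time 0, so that concatenation of paths
    corresponds to composition of maps in the same order. *)
Definition transports c g h : Prop :=
  exists s, [/\ is_lift (`[0, 1]%classic : set R) c s, s 1 = g & s 0 = h].

Lemma unit_interval0 : (`[0, 1]%classic : set R) 0.
Proof. by apply/unit_intervalP; lra. Qed.

Lemma unit_interval1 : (`[0, 1]%classic : set R) 1.
Proof. by apply/unit_intervalP; lra. Qed.

Lemma transports_ext c d g h : (forall t, 0 <= t <= 1 -> c t = d t) ->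
  transports c g h -> transports d g h.
Proof.
move=> cd [s [ls s1 s0]]; exists s; split=> //.
by apply: lift_ext ls => // t /unit_intervalP; exact: cd.
Qed.

Lemma transports_tag c g h : transports c g h -> tag g = c 1 /\ tag h = c 0.
Proof.
by move=> [s [ls <- <-]]; split; apply: lift_tag ls _; [exact: unit_interval1|exact: unit_interval0].
Qed.

(** The path may start off Z at time 1, where the germ is prescribed: this covers
    the paths that leave the knot. *)
Lemma transports_uniq Z c g h h' : evenly_covered F Z ->
  {within `[0, 1], continuous c} -> (forall t, 0 <= t < 1 -> Z (c t)) ->
  transports c g h -> transports c g h' -> h = h'.
Proof.
move=> evZ cc cZ [s [ls s1 s0]] [s' [ls' s'1 s'0]].
rewrite -s0 -s'0.
apply: (lift_unique evZ (@segment_connected R 0 1) cc ls ls' unit_interval1 _ _ unit_interval0).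
  by rewrite s1.
move=> t /unit_intervalP t01 ne.
have t1 : t < 1.
  rewrite lt_neqAle; apply/andP; split; last lra.
  by apply/eqP => t1; apply: ne; rewrite t1 s1.
apply: filterS (lt_nbhsl t1) => t' /= t'1 /unit_intervalP t'01.
by apply: cZ; lra.
Qed.

Lemma transports_inj Z c g g' h : evenly_covered F Z ->
  {within `[0, 1], continuous c} -> (forall t, 0 <= t <= 1 -> Z (c t)) ->
  transports c g h -> transports c g' h -> g = g'.
Proof.
move=> evZ cc cZ [s [ls s1 s0]] [s' [ls' s'1 s'0]].
rewrite -s1 -s'1.
apply: (lift_unique evZ (@segment_connected R 0 1) cc ls ls' unit_interval0 _ _ unit_interval1).
  by rewrite s0.
by move=> t _ _; apply: filterE => t' /unit_intervalP; exact: cZ.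
Qed.

Lemma transports_exists Z c g : evenly_covered F Z ->
  {within `[0, 1], continuous c} -> (forall t, 0 <= t <= 1 -> Z (c t)) ->
  tag g = c 1 -> exists h, transports c g h.
Proof.
move=> evZ cc cZ gc; have [s [ls s1]] := path_liftable evZ cc cZ unit_interval1 gc.
by exists (s 0), s.
Qed.

Lemma transports_exists_start Z c h : evenly_covered F Z ->
  {within `[0, 1], continuous c} -> (forall t, 0 <= t <= 1 -> Z (c t)) ->
  tag h = c 0 -> exists g, transports c g h.
Proof.
move=> evZ cc cZ gc; have [s [ls s0]] := path_liftable evZ cc cZ unit_interval0 gc.
by exists (s 1), s.
Qed.

Lemma lift_vertical f (s : R * R -> etale F) x :
  is_lift unit_square f s -> 0 <= x <= 1 ->
  transports (fun t => f (x, t)) (s (x, 1)) (s (x, 0)).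
Proof.
move=> ls x01; exists (fun t => s (x, t)); split=> //.
apply: (@lift_comp _ _ F _ _ _ (fun t => (x, t)) _ _ _ ls).
  by apply: within_pair; [exact: within_cst|exact: within_id].
by move=> t /unit_intervalP ?; apply/rectP; split=> //; lra.
Qed.

Lemma lift_horizontal f (s : R * R -> etale F) t :
  is_lift unit_square f s -> 0 <= t <= 1 ->
  transports (fun x => f (x, t)) (s (1, t)) (s (0, t)).
Proof.
move=> ls t01; exists (fun x => s (x, t)); split=> //.
apply: (@lift_comp _ _ F _ _ _ (fun x => (x, t)) _ _ _ ls).
  by apply: within_pair; [exact: within_id|exact: within_cst].
by move=> x /unit_intervalP ?; apply/rectP; split=> //; lra.
Qed.

(** A path is a square that is constant in its first coordinate. *)
Lemma transports_exists_exit Z Z' c g : evenly_covered F Z ->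
  evenly_covered F Z' -> {within `[0, 1], continuous c} ->
  (forall t, 0 <= t < 1 -> Z (c t)) -> Z' (c 1) ->
  tag g = c 1 -> exists h, transports c g h.
Proof.
move=> evZ evZ' cc cZ c1 gc.
have sq p : unit_square p -> (`[0, 1]%classic : set R) p.2 by case.
have csnd : {within unit_square, continuous (snd : R * R -> R)}.
  by apply: continuous_subspaceT => ?; exact: cvg_snd.
have cf : {within unit_square, continuous (c \o snd)} := within_comp csnd cc sq.
have x0 : 0 <= (0 : R) <= 1 by lra.
have [||s [ls s01]] := exit_square_lift evZ evZ' cf _ _ x0 gc.
- by move=> s t _; exact: cZ.
- by [].
by exists (s (0, 0)); rewrite -[g]s01; exact: lift_vertical ls x0.
Qed.

Lemma transports_cat c d g g' h : {within `[0, 1], continuous (cat_fun c d)} ->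
  transports c g' h -> transports d g g' -> transports (cat_fun c d) g h.
Proof.
move=> ccat [s [ls s1 s0]] [s' [ls' s'1 s'0]].
have cA : closed (`[0, 2^-1]%classic : set R) by exact: itv_closed.
have cB : closed (`[2^-1, 1]%classic : set R) by exact: itv_closed.
have UE : (`[0, 2^-1]%classic : set R) `|` `[2^-1, 1]%classic = `[0, 1]%classic.
  apply/seteqP; split=> [t [|]|t] /=; rewrite !in_itv /= => t01; [lra|lra|].
  by have [?|?] := leP t 2^-1; [left|right]; lra.
have l1 : is_lift (`[0, 2^-1]%classic : set R) (cat_fun c d) (s \o (fun t => 2 * t + 0)).
  have : is_lift (`[0, 2^-1]%classic : set R) (c \o (fun t => 2 * t + 0))
      (s \o (fun t => 2 * t + 0)).
    apply: lift_comp ls _ _; first exact/continuous_subspaceT/contR_affine.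
    by move=> t /=; rewrite !in_itv /=; lra.
  apply: lift_ext => // t; rewrite /= in_itv /= /cat_fun => t01.
  by have /andP[_ ->] := t01.
have l2 : is_lift (`[2^-1, 1]%classic : set R) (cat_fun c d) (s' \o (fun t => 2 * t + -1)).
  have : is_lift (`[2^-1, 1]%classic : set R) (d \o (fun t => 2 * t + -1))
      (s' \o (fun t => 2 * t + -1)).
    apply: lift_comp ls' _ _; first exact/continuous_subspaceT/contR_affine.
    by move=> t /=; rewrite !in_itv /=; lra.
  apply: lift_ext => // t; rewrite /= in_itv /= /cat_fun => t01.
  case: ifPn => // t2; have -> : t = 2^-1 by lra.
  rewrite (_ : 2 * 2^-1 + 0 = 1); last lra.
  rewrite (_ : 2 * 2^-1 + -1 = 0); last lra.
  by rewrite -(lift_tag ls unit_interval1) -(lift_tag ls' unit_interval0) s1 s'0.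
have [||t [lt tA tB]] := lift_glue cA cB _ l1 l2.
- by rewrite UE.
- move=> t; rewrite /= !in_itv /= => tA tB; have -> : t = 2^-1 by lra.
  rewrite (_ : 2 * 2^-1 + 0 = 1); last lra.
  rewrite (_ : 2 * 2^-1 + -1 = 0); last lra.
  by rewrite s1 s'0.
exists t; split.
- by rewrite -UE.
- rewrite tB /=; last by rewrite in_itv /=; lra.
  by rewrite (_ : 2 * 1 + -1 = 1)//; lra.
- rewrite tA /=; last by rewrite in_itv /=; lra.
  by rewrite mulr0 addr0.
Qed.

Lemma transports_cst Z x g h : evenly_covered F Z -> Z x ->
  transports (fun=> x) g h -> g = h.
Proof.
case: g => y v evZ Zx tr; have [/= yx _] := transports_tag tr; subst y.
have cc := @within_cst R X `[0, 1]%classic x.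
apply/esym; apply: (transports_uniq evZ cc _ tr) => //.
have [U [u [nU uv]]] := stalk_germ v.
have ge : germ_at u x = existT _ x v by rewrite /germ_at uv.
exists (germ_at u \o (fun=> x)); split=> //.
by apply: lift_germ_at => //; [case: nU|move=> _ _; case: nU].
Qed.

Lemma constant_transport Z x (v : stalk F x) : evenly_covered F Z -> Z x ->
  transports (fun=> x) (existT _ x v) (existT _ x v).
Proof.
move=> evZ Zx.
have [h tr] := @transports_exists Z (fun=> x) (existT _ x v) evZ
  (@within_cst _ _ _ _) (fun _ _ => Zx) erefl.
by have e := transports_cst evZ Zx tr; move: tr; rewrite -e.
Qed.

(** A lift of the homotopy is constant along the two sides on which the
    homotopy is constant, so both paths transport between the same germs. *)
Lemma transports_homotopy Z f x y g h : evenly_covered F Z ->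
  {within unit_square, continuous f} ->
  (forall p, unit_square p -> Z (f p)) ->
  (forall s, 0 <= s <= 1 -> f (s, 0) = x /\ f (s, 1) = y) ->
  transports (fun t => f (0, t)) g h -> transports (fun t => f (1, t)) g h.
Proof.
move=> evZ cf fZ fxy tr.
have i0 : 0 <= (0 : R) <= 1 by lra.
have i1 : 0 <= (1 : R) <= 1 by lra.
have sq s t : 0 <= s <= 1 -> 0 <= t <= 1 -> @unit_square R (s, t).
  by move=> *; apply/unit_squareP.
have [tg _] := transports_tag tr.
have lf : liftable F unit_square f by apply: (rect_liftable _ _ evZ cf fZ).
have [s [ls sg]] := lf (0, 1) g (sq _ _ i0 i1) tg.
have const t z : 0 <= t <= 1 -> (forall s, 0 <= s <= 1 -> f (s, t) = z) ->
    s (1, t) = s (0, t).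
  move=> t01 fz; apply: (transports_cst evZ (x := z)).
    by rewrite -(fz 0 i0); apply: fZ; exact: sq.
  by apply: transports_ext (lift_horizontal ls t01).
have <- : s (1, 1) = g.
  by rewrite (const 1 y)// => x' /fxy[].
have <- : s (1, 0) = h.
  rewrite (const 0 x)//; last by move=> x' /fxy[].
  have cv : {within `[0, 1], continuous (fun t => f (0, t))}.
    have cp : {within `[0, 1], continuous (fun t : R => (0 : R, t))}.
      by apply: within_pair; [exact: within_cst|exact: within_id].
    by apply: (within_comp cp cf) => t /unit_intervalP; exact: sq.
  apply: (transports_uniq evZ cv _ (lift_vertical ls i0)).
    by move=> t t01; apply: fZ; apply: sq => //; lra.
  by rewrite sg.
exact: lift_vertical ls i1.
Qed.

(** The linear structure of the stalks, as an operation on the total space: it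
    lets the sum of two lifts be formed without comparing the stalks over the
    values of the path. The value on germs over different points is arbitrary. *)
Definition lincomb (a : k) g h : etale F :=
  if pselect (tag h = tag g) is left e
  then existT (stalk F) (tag g) (a *: tagged g + eq_rect _ (stalk F) (tagged h) _ e)
  else g.

Lemma lincombE a x (v w : stalk F x) :
  lincomb a (existT _ x v) (existT _ x w) = existT _ x (a *: v + w).
Proof.
rewrite /lincomb; case: pselect => //= e.
by rewrite (Prop_irrelevance e erefl).
Qed.

Lemma lift_lincomb (A : set R) c (s s' : R -> etale F) a :
  is_lift A c s -> is_lift A c s' -> is_lift A c (fun t => lincomb a (s t) (s' t)).
Proof.
move=> ls ls' y Ay.
have [U [u [nU hu]]] := ls y Ay; have [V [v [nV hv]]] := ls' y Ay.
have nI : open_nbhs (c y) (U `&` V) by exact: open_nbhs_setI.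
exists (U `&` V), (a *: res F _ u + res F _ v); split=> //.
apply: filterS2 hu hv => t hu hv At.
have [Ut ->] := hu At; have [Vt ->] := hv At; split=> //.
have nt : open_nbhs (c t) (U `&` V) by split=> //; case: nI.
rewrite /germ_at lincombE germ_linear !germ_res//; try exact: subIsetr;
  try exact: subIsetl; by [case: nU|case: nV].
Qed.

Lemma transports_lincomb c x y (v v' : stalk F x) (w w' : stalk F y) a :
  transports c (existT _ x v) (existT _ y w) ->
  transports c (existT _ x v') (existT _ y w') ->
  transports c (existT _ x (a *: v + v')) (existT _ y (a *: w + w')).
Proof.
move=> [s [ls s1 s0]] [s' [ls' s'1 s'0]].
exists (fun t => lincomb a (s t) (s' t)); split; first exact: lift_lincomb.
  by rewrite s1 s'1 lincombE.
by rewrite s0 s'0 lincombE.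
Qed.

Lemma transport_linear c x y :
  (forall v : stalk F x, exists h, transports c (existT _ x v) h) ->
  (forall g h h', transports c g h -> transports c g h' -> h = h') ->
  c 0 = y ->
  exists T : {linear stalk F x -> stalk F y}, forall v,
    transports c (existT _ x v) (existT _ y (T v)).
Proof.
move=> ex uniq c0.
have ex' v : exists w : stalk F y, transports c (existT _ x v) (existT _ y w).
  have [[z w] tr] := ex v; have [_ /= zy] := transports_tag tr.
  by rewrite c0 in zy; subst z; exists w.
pose T v := xget 0 [set w | transports c (existT _ x v) (existT _ y w)].
have TE v : transports c (existT _ x v) (existT _ y (T v)).
  by rewrite /T; case: xgetP => [w _ //|]; have [w hw] := ex' v => /(_ w).
have linT : linear T.
  move=> a v w; apply: existT_inj2.
  by apply: uniq (TE _) _; exact: transports_lincomb.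
pose TL := GRing.isLinear.Build k _ _ _ T linT.
pose T' : {linear stalk F x -> stalk F y} := HB.pack T TL.
by exists T'.
Qed.

Lemma monodromyE c x (v w : stalk F x) :
  (forall g h h', transports c g h -> transports c g h' -> h = h') ->
  transports c (existT _ x v) (existT _ x w) -> monodromy c v = w.
Proof.
move=> uniq tr; rewrite /monodromy.
case: xgetP => [w' _ [s [/lift_pullback ls s1 s0]]|].
  apply: existT_inj2; apply: uniq tr.
  by exists (fun t => existT _ (c t) (s t)).
move=> /(_ w); case.
have [s [ls s1 s0]] := tr.
pose t u : stalk F (c u) :=
  if pselect (tag (s u) = c u) is left e then eq_rect _ (stalk F) (tagged (s u)) _ e
  else 0.
have tE u : tag (s u) = c u -> s u = existT _ (c u) (t u).
  rewrite /t; case: pselect => // e _; move: e; case: (s u) => z z' /= e.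
  by subst z.
exists t; split.
- apply/lift_pullback; apply: (lift_ext _ _ ls) => // u hu; apply: tE.
  exact: lift_tag ls hu.
- by rewrite -tE ?s1//; rewrite -s1; exact: lift_tag ls unit_interval1.
- by rewrite -tE ?s0//; rewrite -s0; exact: lift_tag ls unit_interval0.
Qed.

End Transport.

(** * Coordinates, rank one maps and the cord algebra *)

Section Coordinates.
Context {k : fieldType}.
Implicit Types V W : lmodType k.

Definition finite_dim V : Prop :=
  exists (n : nat) (e : {linear V -> 'rV[k]_n}), bijective e.

(** The matrix of f in the coordinates that define [trace]. It acts on row
    vectors, so composition of maps reverses products of matrices. *)
Definition coord_mx V W (f : V -> W) : 'M[k]_(dimension V, dimension W) :=
  \matrix_i tagged (coordinates W)
    (f (xget 0 [set v | tagged (coordinates V) v = delta_mx 0 i])).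

Lemma coordinates_iso V : finite_dim V ->
  exists2 e : {linear V -> 'rV[k]_(dimension V)},
    bijective e & tagged (coordinates V) = e :> (V -> 'rV[k]_(dimension V)).
Proof.
move=> [n [e be]].
have [lin bij] : linear (tagged (coordinates V)) /\ bijective (tagged (coordinates V)).
  rewrite /coordinates; case: xgetP => [f _ //|].
  move=> /(_ (existT (fun n => V -> 'rV[k]_n) n (e : V -> 'rV[k]_n))); case.
  by split=> //; exact: linearP.
pose L := GRing.isLinear.Build k _ _ _ (tagged (coordinates V)) lin.
pose e' : {linear V -> 'rV[k]_(dimension V)} := HB.pack (tagged (coordinates V)) L.
by exists e'.
Qed.

Lemma traceE V (f : V -> V) : trace f = \tr (coord_mx f).
Proof. by []. Qed.

Lemma coord_mxP V W (f : {linear V -> W}) v : finite_dim V -> finite_dim W ->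
  tagged (coordinates W) (f v) = tagged (coordinates V) v *m coord_mx f.
Proof.
move=> /coordinates_iso[eV bV EV] /coordinates_iso[eW bW EW].
have [iV VK KV] := bV.
pose b i := iV (delta_mx 0 i).
have bE i : xget 0 [set v | tagged (coordinates V) v = delta_mx 0 i] = b i.
  case: xgetP => [w _ /=|/(_ (b i))]; rewrite EV; last by case; rewrite /= KV.
  by move=> ew; apply: (bij_inj bV); rewrite KV.
have -> : coord_mx f = \matrix_i eW (f (b i)).
  by apply/row_matrixP => i; rewrite !rowK EW bE.
rewrite EV EW.
have {1}-> : v = \sum_i eV v 0 i *: b i.
  apply: (bij_inj bV); rewrite linear_sum {1}(row_sum_delta (eV v)).
  by apply: eq_bigr => i _; rewrite linearZ /= KV.
rewrite mulmx_sum_row !linear_sum; apply: eq_bigr => i _.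
by rewrite !linearZ /= rowK.
Qed.

Lemma coord_mx_uniq V W (f : V -> W) M : finite_dim V ->
  (forall v, tagged (coordinates W) (f v) = tagged (coordinates V) v *m M) ->
  coord_mx f = M.
Proof.
move=> /coordinates_iso[eV [iV VK KV] EV] h.
apply/row_matrixP => i; rewrite rowK h rowE; congr (_ *m _).
case: xgetP => [w _ //|/(_ (iV (delta_mx 0 i)))]; rewrite EV; case.
by rewrite /= KV.
Qed.

Lemma coord_surj V : finite_dim V -> forall x, exists v,
  tagged (coordinates V) v = x.
Proof. by move=> /coordinates_iso[e [i eK iK] E] x; exists (i x); rewrite E iK. Qed.

Lemma coord_inj V : finite_dim V -> injective (tagged (coordinates V)).
Proof. by move=> /coordinates_iso[e be E]; rewrite E; exact: bij_inj. Qed.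

Lemma coord0 V : finite_dim V -> tagged (coordinates V) 0 = 0.
Proof. by move=> /coordinates_iso[e _ E]; rewrite E linear0. Qed.

End Coordinates.

Section RankOne.
Context {k : fieldType}.

Lemma mul_cV11 n (phi : 'cV[k]_n) (x : 'M[k]_1) : phi *m x = x 0 0 *: phi.
Proof. by rewrite {1}[x]mx11_scalar mul_mx_scalar. Qed.

Lemma mul_rV11 n (x : 'M[k]_1) (psi : 'rV[k]_n) : x *m psi = x 0 0 *: psi.
Proof. by rewrite {1}[x]mx11_scalar mul_scalar_mx. Qed.

(** The row space of A has the line of u as a complement, and A' inverts A along
    it: 1 - phi u is a projection onto the row space of A, hence a multiple of A. *)
Lemma corank1_splitting q n (A : 'M[k]_(q, n)) (phi : 'cV[k]_n) (u : 'rV[k]_n) :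
  row_free A -> u *m phi = 1%:M -> A *m phi = 0 ->
  (forall x : 'rV[k]_n, x *m phi = 0 -> (x <= A)%MS) ->
  exists A', A *m A' = 1%:M /\ A' *m A + phi *m u = 1%:M.
Proof.
move=> fA uphi Aphi kerA.
have /submxP[A' eA'] : (1%:M - phi *m u <= A)%MS.
  apply/row_subP => i; apply: kerA; rewrite -row_mul mulmxBl mul1mx -mulmxA uphi.
  by rewrite mulmx1 subrr row0.
exists A'; split; last by rewrite -eA' subrK.
apply: (row_free_inj fA); rewrite mul1mx -mulmxA -eA' mulmxBr mulmx1.
by rewrite mulmxA Aphi mul0mx subr0.
Qed.

(** The dual statement: a row kap spanning the left kernel of a row full matrix
    splits the source as a copy of the target plus a line. *)
Lemma nullity1_splitting q n (A : 'M[k]_(q, n)) (kap : 'rV[k]_q) :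
  row_full A -> kap != 0 -> kap *m A = 0 ->
  (forall x : 'rV[k]_q, x *m A = 0 -> exists a, x = a *: kap) ->
  exists A' psi, [/\ A' *m A = 1%:M, A *m A' + psi *m kap = 1%:M &
    kap *m psi = 1%:M].
Proof.
move=> fA kap0 kapA kerA; have [A' A'A] := row_fullP fA.
have /submxP[psi epsi] : (1%:M - A *m A' <= kap)%MS.
  apply/row_subP => i; apply/sub_rVP/kerA.
  by rewrite -row_mul mulmxBl mul1mx -mulmxA A'A mulmx1 subrr row0.
exists A', psi; split=> //; first by rewrite -epsi addrC subrK.
have : (kap *m psi) *m kap = kap.
  by rewrite -mulmxA -epsi mulmxBr mulmx1 mulmxA kapA mul0mx subr0.
rewrite mul_rV11 => /eqP; rewrite -[X in _ == X]scale1r -subr_eq0 -scalerBl.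
rewrite scaler_eq0 (negbTE kap0) orbF subr_eq0 => /eqP e.
by rewrite [LHS]mx11_scalar e.
Qed.

End RankOne.

Section CordMorphism.
Context {G : groupType} {k : fieldType} (m l : G).

(** What the generators may be sent to in a field: invertible means nonzero
    there, and the other fields are the defining relations of the cord algebra. *)
Record cord_relations (lam mu : k) (c : G -> k) : Prop := CordRelations {
  cord_lam_neq0 : lam != 0;
  cord_mu_neq0 : mu != 0;
  cord_one : c 1%g = 1 - mu;
  cord_mulm g : c (g * m)%g = mu * c g;
  cord_mmul g : c (m * g)%g = mu * c g;
  cord_mull g : c (g * l)%g = lam * c g;
  cord_lmul g : c (l * g)%g = lam * c g;
  cord_skein g1 g2 : c (g1 * g2)%g - c (g1 * m * g2)%g - c g1 * c g2 = 0
}.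

Fixpoint cord_eval (lam mu : k) (c : G -> k) (a : cord_expr) : k :=
  match a with
  | CZero => 0
  | COne => 1
  | COpp a => - cord_eval lam mu c a
  | CAdd a b => cord_eval lam mu c a + cord_eval lam mu c b
  | CMul a b => cord_eval lam mu c a * cord_eval lam mu c b
  | CLambda => lam
  | CLambdaInv => lam^-1
  | CMu => mu
  | CMuInv => mu^-1
  | CCord g => c g
  end.

Lemma cord_eval_eq lam mu c a b : cord_relations lam mu c ->
  cord_eq m l a b -> cord_eval lam mu c a = cord_eval lam mu c b.
Proof.
move=> [l0 m0 c1 cm mc cl lc sk]; elim=> //=; intros; try congruence.
- by rewrite addrA.
- by rewrite addrC.
- by rewrite add0r.
- by rewrite addNr.
- by rewrite mulrA.
- by rewrite mul1r.
- by rewrite mulr1.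
- by rewrite mulrDl.
- by rewrite mulrDr.
- by rewrite mulrC.
- by rewrite mulrC.
- by rewrite divff.
- by rewrite divff.
Qed.

Lemma cord_augmentation lam mu c : cord_relations lam mu c ->
  exists eps : {rmorphism cord_algebra m l -> k},
    [/\ eps (cord_lambda m l) = lam, eps (cord_mu m l) = mu &
        forall g, eps (cord m l g) = c g].
Proof.
move=> rel.
pose f (u : cord_algebra m l) := cord_eval lam mu c (repr u).
have fE a : f (cord_pi m l a) = cord_eval lam mu c a.
  exact: cord_eval_eq rel (cord_repr m l a).
have fB : zmod_morphism f.
  elim/(@cord_ind G m l) => a; elim/(@cord_ind G m l) => b.
  have -> : cord_pi m l a - cord_pi m l b = cord_pi m l (CAdd a (COpp b)).
    by rewrite /GRing.opp /GRing.add /= cord_oppE cord_addE.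
  by rewrite !fE.
have fM : monoid_morphism f.
  split; first by rewrite /GRing.one /= fE.
  elim/(@cord_ind G m l) => a; elim/(@cord_ind G m l) => b.
  have -> : cord_pi m l a * cord_pi m l b = cord_pi m l (CMul a b).
    by rewrite /GRing.mul /= cord_mulE.
  by rewrite !fE.
pose ZM := GRing.isZmodMorphism.Build _ _ f fB.
pose MM := GRing.isMonoidMorphism.Build _ _ f fM.
pose eps : {rmorphism cord_algebra m l -> k} := HB.pack f ZM MM.
by exists eps; split=> [||g]; exact: fE.
Qed.

End CordMorphism.

(** * The augmentation of a simple representation *)

Section SimpleRepresentation.
Context {k : fieldType} {G : groupType} (m l : G) {q n : nat}.
Variables (rho : G -> 'M[k]_n) (B : 'M[k]_q) (A : 'M[k]_(q, n)).
Hypothesis rho1 : rho 1%g = 1%:M.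
(* matrices act on rows on the right, whence the order *)
Hypothesis rhoM : forall g h, rho (g * h)%g = rho h *m rho g.
Hypothesis ml : rho m *m rho l = rho l *m rho m.
Hypothesis Am : A *m rho m = A.
Hypothesis Al : A *m rho l = B *m A.

Let lam := \tr (rho l) - \tr B.
Let mu := \tr (rho m) - n%:R + 1.
Let c g := \tr (rho g - rho (m * g)%g).

Lemma trace_skew g : c g = \tr (rho g *m (1%:M - rho m)).
Proof. by rewrite /c rhoM mulmxBr mulmx1. Qed.

Lemma rho_eigen_neq0 g (a : k) (phi : 'cV[k]_n) : phi != 0 ->
  rho g *m phi = a *: phi -> a != 0.
Proof.
move=> phi0 e; apply: contraNneq phi0 => a0.
have : rho g^-1 *m (rho g *m phi) = phi.
  by rewrite mulmxA -rhoM mulgV rho1 mul1mx.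
by rewrite e a0 scale0r mulmx0 => <-.
Qed.

(** The column phi is a linear form vanishing on the image of T, which m fixes;
    hence 1 - rho m is phi times a row psi. All the values of the augmentation
    become matrix coefficients psi rho(g) phi, of which phi and psi are
    eigenvectors for m and l; the skein relation is the factorization through
    phi psi. *)
Lemma cord_relations_corank1 (phi : 'cV[k]_n) (u : 'rV[k]_n) :
  row_free A -> u *m phi = 1%:M -> A *m phi = 0 ->
  (forall x : 'rV[k]_n, x *m phi = 0 -> (x <= A)%MS) ->
  cord_relations m l lam mu c.
Proof.
move=> fA uphi Aphi kerA.
have [A' [AA' split1]] := corank1_splitting fA uphi Aphi kerA.
have phi0 : phi != 0.
  apply: contra_eqT uphi => /negPn/eqP ->; rewrite mulmx0 eq_sym.
  by apply/eqP => /matrixP/(_ 0 0)/eqP; rewrite !mxE oner_eq0.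
pose psi := u *m (1%:M - rho m).
have rank1 : 1%:M - rho m = phi *m psi.
  have : (A' *m A + phi *m u) *m (1%:M - rho m) = 1%:M - rho m.
    by rewrite split1 mul1mx.
  by rewrite mulmxDl -!mulmxA (mulmxBr A) mulmx1 Am subrr mulmx0 add0r => <-.
have cE g : c g = (psi *m rho g *m phi) 0 0.
  by rewrite trace_skew rank1 mulmxA mxtrace_mulC mulmxA trace_mx11.
have muE : mu = 1 - (psi *m phi) 0 0.
  have : \tr (1%:M - rho m) = (psi *m phi) 0 0.
    by rewrite rank1 mxtrace_mulC trace_mx11.
  by rewrite raddfB /= mxtrace1 => <-; rewrite /mu; ring.
have rhomE : rho m = 1%:M - phi *m psi by rewrite -rank1 opprB addrC subrK.
have mphi : rho m *m phi = mu *: phi.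
  by rewrite rhomE mulmxBl mul1mx -mulmxA mul_cV11 muE scalerBl scale1r.
have psim : psi *m rho m = mu *: psi.
  by rewrite rhomE mulmxBr mulmx1 mulmxA mul_rV11 muE scalerBl scale1r.
pose lam' : k := (u *m rho l *m phi) 0 0.
have lphi : rho l *m phi = lam' *: phi.
  rewrite -[LHS]mul1mx -split1 mulmxDl -!mulmxA (mulmxA A) Al -mulmxA Aphi.
  by rewrite !mulmx0 add0r (mulmxA u) mul_cV11.
have psil : psi *m rho l = lam' *: psi.
  have comm : (1%:M - rho m) *m rho l = rho l *m (1%:M - rho m).
    by rewrite mulmxBl mulmxBr mul1mx mulmx1 ml.
  by rewrite {1}/psi -mulmxA comm rank1 !mulmxA mul_rV11 -scalemxAl.
have lamE : lam = lam'.
  have : \tr (rho l *m (A' *m A + phi *m u)) = \tr (rho l).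
    by rewrite split1 mulmx1.
  rewrite mulmxDr mxtraceD !mulmxA mxtrace_mulC mulmxA Al -(mulmxA B) AA' mulmx1.
  by rewrite mxtrace_mulC mulmxA trace_mx11 -/lam' /lam => <-; rewrite addrC addKr.
have scal (a : k) (x : 'M[k]_1) : (a *: x) 0 0 = a * x 0 0 by rewrite mxE.
split.
- by rewrite lamE; exact: rho_eigen_neq0 lphi.
- exact: rho_eigen_neq0 mphi.
- by rewrite cE rho1 mulmx1 muE opprB addrC subrK.
- by move=> g; rewrite !cE rhoM mulmxA psim -!scalemxAl scal.
- by move=> g; rewrite !cE rhoM -!mulmxA mphi -!scalemxAr scal.
- by move=> g; rewrite !cE rhoM mulmxA psil -!scalemxAl scal lamE.
- by move=> g; rewrite !cE rhoM -!mulmxA lphi -!scalemxAr scal lamE.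
- move=> g1 g2; rewrite !cE !rhoM.
  rewrite rhomE; pose x := psi *m rho g2; pose y := rho g1 *m phi.
  have -> : psi *m (rho g2 *m ((1%:M - phi *m psi) *m rho g1)) *m phi =
      x *m y - (x *m phi) *m (psi *m y).
    by rewrite mulmxBl mul1mx !mulmxBr mulmxBl !mulmxA.
  rewrite mul_rV11 -(mulmxA psi) -(mulmxA psi (rho g2)) -/y.
  rewrite (mulmxA psi (rho g2)) -/x -(mulmxA (rho g2)) -/y !mulmxA -/x.
  rewrite -(mulmxA x) -/y -(mulmxA psi) -/y !mxE.
  ring.
Qed.

(** When T is onto, m acts trivially, all cords go to 0, and - lam is the
    eigenvalue of the monodromy of the knot on the kernel of T. *)
Lemma cord_relations_nullity1 (kap : 'rV[k]_q) :
  row_full A -> row_free B -> kap != 0 -> kap *m A = 0 ->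
  (forall x : 'rV[k]_q, x *m A = 0 -> exists a, x = a *: kap) ->
  cord_relations m l lam mu c.
Proof.
move=> fA fB kap0 kapA kerA.
have [A' [psi [A'A split1 kappsi]]] := nullity1_splitting fA kap0 kapA kerA.
have m1 : rho m = 1%:M by rewrite -[LHS]mul1mx -A'A -mulmxA Am.
have c0 g : c g = 0 by rewrite trace_skew m1 subrr mulmx0 mxtrace0.
have mu1 : mu = 1 by rewrite /mu m1 mxtrace1 subrr add0r.
have [a kapB] : exists a, kap *m B = a *: kap.
  by apply: kerA; rewrite -mulmxA -Al mulmxA kapA mul0mx.
have lamE : lam = - a.
  have : \tr (B *m (A *m A' + psi *m kap)) = \tr B by rewrite split1 mulmx1.
  rewrite mulmxDr mxtraceD !mulmxA -Al -(mulmxA A) mxtrace_mulC -(mulmxA (rho l)) A'A mulmx1.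
  rewrite [X in _ + X]mxtrace_mulC mulmxA kapB -scalemxAl kappsi mxtraceZ.
  by rewrite mxtrace1 mulr1 /lam => <-; rewrite opprD addrA subrr add0r.
split; rewrite ?mu1 ?oner_eq0// => *; rewrite ?c0 ?mulr0 ?subrr ?subr0//.
rewrite lamE oppr_eq0; apply: contraNneq kap0 => a0.
by apply/eqP/(row_free_inj fB); rewrite kapB a0 scale0r mul0mx.
Qed.

End SimpleRepresentation.

Section SimpleMaps.
Context {k : fieldType} {G : groupType} (m l : G) {V W : lmodType k}.

Definition simple_map (T : {linear W -> V}) : Prop :=
  injective T /\ rank1_cokernel T \/
  (forall v, exists w, T w = v) /\ rank1_kernel T.

Lemma cord_relations_simple (rho : G -> {linear V -> V})
    (rho' : {linear W -> W}) (T : {linear W -> V}) :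
  finite_dim V -> finite_dim W ->
  (forall v, rho 1%g v = v) ->
  (forall g h v, rho (g * h)%g v = rho g (rho h v)) ->
  (forall v, rho m (rho l v) = rho l (rho m v)) ->
  (forall w, rho m (T w) = T w) -> (forall w, rho l (T w) = T (rho' w)) ->
  injective rho' -> simple_map T ->
  cord_relations m l (trace (rho l) - trace rho')
    (trace (rho m) - (dimension V)%:R + 1)
    (fun g => trace (rho g \- rho (m * g)%g)).
Proof.
move=> fV fW rho1 rhoM ml Tm Tl rho'I simp.
pose M g := coord_mx (rho g); pose A := coord_mx T; pose B := coord_mx rho'.
have cV := coord_mxP _ _ fV fV; have iV := coord_inj fV; have iW := coord_inj fW.
have M1 : M 1%g = 1%:M.
  by apply: coord_mx_uniq => // v; rewrite rho1 mulmx1.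
have MM g h : M (g * h)%g = M h *m M g.
  by apply: coord_mx_uniq => // v; rewrite rhoM !coord_mxP// mulmxA.
have cml : M m *m M l = M l *m M m.
  rewrite -!MM; apply: coord_mx_uniq => // v.
  by rewrite -coord_mxP// !rhoM ml.
have Am : A *m M m = A.
  apply/esym/coord_mx_uniq => // w.
  by rewrite mulmxA -coord_mxP// -coord_mxP// Tm.
have Al : A *m M l = B *m A.
  rewrite -[RHS](@coord_mx_uniq _ _ _ (T \o rho') (B *m A))//; last first.
    by move=> w /=; rewrite !coord_mxP// mulmxA.
  apply/esym/coord_mx_uniq => // w.
  by rewrite /= -Tl !coord_mxP// mulmxA.
have cE g : trace (rho g \- rho (m * g)%g) = \tr (M g - M (m * g)%g).
  rewrite traceE; congr (\tr _); apply: coord_mx_uniq => // v.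
  have [e _ E] := coordinates_iso fV.
  by rewrite mulmxBr -!coord_mxP// E linearB.
have -> : (fun g => trace (rho g \- rho (m * g)%g)) =
    (fun g => \tr (M g - M (m * g)%g)) by apply/funext.
have freeI (U : lmodType k) (S : {linear W -> U}) : finite_dim U -> injective S ->
    row_free (coord_mx S).
  move=> fU SI; apply/inj_row_free => x xS; have [w wx] := coord_surj fW x.
  suff w0 : w = 0 by rewrite -wx w0 coord0.
  apply: SI; apply: (coord_inj fU).
  by rewrite coord_mxP// wx xS linear0 coord0.
case: simp => [[TI [p [pS pK]]]|[TS [w0 w00 TK]]].
- have [e _ E] := coordinates_iso fV; have sV := coord_surj fV; rewrite E in sV.
  have [i iP] := choice sV.
  pose phi : 'cV[k]_(dimension V) := \col_j p (i (delta_mx 0 j)).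
  have pE v : e v *m phi = (p v : k)%:M.
    have {2}-> : v = \sum_j e v 0 j *: i (delta_mx 0 j).
      apply: iV; rewrite E linear_sum {1}(row_sum_delta (e v)).
      by apply: eq_bigr => j _; rewrite linearZ /= iP.
    rewrite linear_sum [LHS]mx11_scalar mxE; congr (_ %:M).
    by apply: eq_bigr => j _; rewrite mxE linearZ.
  have [v1 pv1] := pS 1.
  apply: (cord_relations_corank1 M1 MM cml Am Al (phi := phi) (u := e v1)).
  + exact: freeI.
  + by rewrite pE pv1.
  + apply/row_matrixP => j; rewrite row_mul row0 rowE.
    have [w <-] := coord_surj fW (delta_mx 0 j).
    rewrite -coord_mxP// E pE (proj2 (pK _)) ?raddf0//.
    by exists w.
  + move=> x; have [v <-] := sV x; rewrite pE => pv0.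
    have [|w <-] := proj1 (pK v).
      by move/matrixP/(_ 0 0): pv0; rewrite !mxE.
    by rewrite -E coord_mxP//; exact: submxMl.
- apply: (cord_relations_nullity1 (l := l) MM Am Al
    (kap := tagged (coordinates W) w0)).
  + rewrite -sub1mx; apply/row_subP => j.
    have [v <-] := coord_surj fV (row j 1%:M); have [w <-] := TS v.
    by rewrite coord_mxP//; exact: submxMl.
  + exact: freeI.
  + by apply: contra_neq w00 => e0; apply: iW; rewrite e0 coord0.
  + rewrite -coord_mxP// (proj2 (TK w0)) ?coord0//.
    by exists 1; rewrite scale1r.
  + move=> x; have [w <-] := coord_surj fW x; rewrite -coord_mxP// => Tw0.
    have [|a ->] := proj1 (TK w); first by apply: iV; rewrite Tw0 coord0.
    by exists a; have [e _ E] := coordinates_iso fW; rewrite E linearZ.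
Qed.

End SimpleMaps.

(** * Monodromy of a local system *)

Section Monodromy.
Context {R : realType} {k : fieldType} {X : topologicalType} (F : sheaf k X).
Context (Z : set X) (evZ : evenly_covered F Z) (b : set_type Z).
Implicit Types (c d : loop R b) (g : pi1 R b).

Definition pi1_monodromy g : stalk F (set_val b) -> stalk F (set_val b) :=
  @monodromy _ _ F R (fun t => set_val (repr g t)) (set_val b).

Let path c : R -> X := fun t => set_val (c t).

Lemma loop_path_continuous c : {within `[0, 1], continuous (path c)}.
Proof.
have cs : {within [set: set_type Z], continuous (set_val : set_type Z -> X)}.
  exact/continuous_subspaceT/set_val_cont.
exact: (within_comp (@loop_continuous _ _ _ c) cs).
Qed.

Lemma loop_path_in c t : Z (path c t).
Proof. exact: set_valP. Qed.

Lemma loop_transports_uniq c (g h h' : etale F) :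
  transports (path c) g h -> transports (path c) g h' -> h = h'.
Proof.
move=> gh; apply: (transports_uniq evZ (@loop_path_continuous c) _ gh) => t _.
exact: loop_path_in.
Qed.

Lemma loop_transport c : exists T : {linear stalk F (set_val b) -> stalk F (set_val b)},
  forall v, transports (path c) (existT (stalk F) (set_val b) v) (existT _ (set_val b) (T v)).
Proof.
apply: transport_linear.
- move=> v; apply: (transports_exists evZ (@loop_path_continuous c)).
    by move=> t _; exact: loop_path_in.
  by rewrite /path loop_end.
- exact: loop_transports_uniq.
- by rewrite /path loop_start.
Qed.

Lemma transports_homotopic c d (g h : etale F) : homotopic c d ->
  transports (path c) g h -> transports (path d) g h.
Proof.
move=> /asboolP[H [cH bH]] tr.
have cf : {within unit_square, continuous (set_val \o H)}.
  have cs : {within [set: set_type Z], continuous (set_val : set_type Z -> X)}.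
    exact/continuous_subspaceT/set_val_cont.
  exact: (within_comp cH cs).
have e1 : transports (fun t => (set_val \o H) (1, t)) g h.
  apply: (transports_homotopy evZ cf (x := set_val b) (y := set_val b)).
  - by move=> p _; exact: set_valP.
  - by move=> s /bH[_ _ /= -> ->].
  - by apply: transports_ext tr => t /bH[/= -> _ _ _].
by apply: transports_ext e1 => t /bH[_ /= -> _ _].
Qed.

Lemma pi1_monodromyE c v w :
  transports (path c) (existT (stalk F) (set_val b) v) (existT _ (set_val b) w) ->
  pi1_monodromy (loop_class c) v = w.
Proof.
move=> tr; apply: monodromyE; first exact: loop_transports_uniq.
by apply: transports_homotopic tr; rewrite homotopic_sym; exact: homotopic_repr.
Qed.

Lemma pi1_monodromy_transports c v :
  transports (path c) (existT (stalk F) (set_val b) v)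
    (existT _ (set_val b) (pi1_monodromy (loop_class c) v)).
Proof. by have [T TE] := loop_transport c; rewrite (pi1_monodromyE (TE v)). Qed.

Lemma pi1_monodromy_linear g :
  exists T : {linear stalk F (set_val b) -> stalk F (set_val b)},
  pi1_monodromy g = T :> (stalk F (set_val b) -> stalk F (set_val b)).
Proof.
have [T TE] := loop_transport (repr g); exists T.
by apply/funext => v; rewrite -[g]loop_class_repr; exact: pi1_monodromyE.
Qed.

Lemma pi1_monodromy1 v : pi1_monodromy 1%g v = v.
Proof.
apply: pi1_monodromyE.
have [T TE] := loop_transport (loop_cst b).
have e := transports_cst evZ (loop_path_in (loop_cst b) 0) (TE v).
by have := TE v; rewrite -e.
Qed.

Lemma pi1_monodromyM g h v :
  pi1_monodromy (g * h)%g v = pi1_monodromy g (pi1_monodromy h v).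
Proof.
rewrite -[g]loop_class_repr -[h]loop_class_repr.
move: (repr g) (repr h) => {g h} c d.
have -> : (loop_class c * loop_class d)%g = loop_class (loop_cat c d).
  exact: pi1_mulE.
apply: pi1_monodromyE.
have pcat t : path (loop_cat c d) t = cat_fun (path c) (path d) t.
  by rewrite /path /= /cat_fun; case: ifP.
have cc : {within `[0, 1], continuous (cat_fun (path c) (path d))}.
  by apply: within_eq (@loop_path_continuous (loop_cat c d)) => t _.
apply: (@transports_ext _ _ _ _ (cat_fun (path c) (path d))) => //.
by apply: (transports_cat cc); exact: pi1_monodromy_transports.
Qed.

End Monodromy.

Section StalkDimension.
Context {k : fieldType} {X : topologicalType} (F : sheaf k X).

Lemma local_system_finite_dim (Y : topologicalType) (f : Y -> X) y :
  pullback_local_system F f -> finite_dim (stalk F (f y)).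
Proof.
move=> /(_ y)[V [n [phi [[_ Vy] bij _]]]].
by exists n, (phi y); exact: bij.
Qed.

Lemma germ_sum x (U : set X) n (a : 'I_n -> k) (u : 'I_n -> F U) :
  germ F x (\sum_i a i *: u i) = \sum_i a i *: germ F x (u i).
Proof.
pose GL := GRing.isLinear.Build k _ _ _ (fun u : F U => germ F x u) (@germ_linear _ _ F x U).
pose G : {linear F U -> stalk F x} := HB.pack (fun u : F U => germ F x u) GL.
rewrite -[LHS]/(G _) linear_sum; apply: eq_bigr => i _.
by rewrite linearZ.
Qed.

(** A finite dimensional stalk is generated by finitely many sections, so all
    its germs extend to one common neighbourhood. *)
Lemma germs_extend x : finite_dim (stalk F x) ->
  exists U, open_nbhs x U /\ forall v : stalk F x, exists u : F U, germ F x u = v.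
Proof.
move=> [n [e [i eK iK]]].
have hu j : exists Uu : {U : set X & F U},
    open_nbhs x (tag Uu) /\ germ F x (tagged Uu) = i (delta_mx 0 j).
  have [U [u [nU uE]]] := stalk_germ (i (delta_mx 0 j)).
  by exists (existT _ U u).
have [Uu hUu] := choice hu.
pose U := [set y | forall j : 'I_n, tag (Uu j) y]^°.
have nU : open_nbhs x U.
  split; first exact: open_interior.
  apply: filter_forall => j; apply: open_nbhs_nbhs.
  by have [] := hUu j.
exists U; split=> // v.
have sU j : U `<=` tag (Uu j) by move=> y /nbhs_singleton.
exists (\sum_j e v 0 j *: res F U (tagged (Uu j))).
rewrite germ_sum; apply: (can_inj eK); rewrite linear_sum.
rewrite [RHS](row_sum_delta (e v)); apply: eq_bigr => j _.
have [[oj _] uj] := hUu j.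
by rewrite linearZ /= germ_res// uj iK.
Qed.

Lemma simple_map_iso (V V' W : lmodType k) (T : {linear W -> V})
    (T' : {linear W -> V'}) (Phi : {linear V' -> V}) : bijective Phi ->
  (forall w, T w = Phi (T' w)) -> simple_map T' -> simple_map T.
Proof.
move=> [Psi PhiK PsiK] TE.
have linPsi : linear Psi.
  by move=> a v w; apply: (can_inj PhiK); rewrite linearP !PsiK.
pose PL := GRing.isLinear.Build k _ _ _ Psi linPsi.
pose P : {linear V -> V'} := HB.pack Psi PL.
move=> [[T'I [p [pS pK]]]|[T'S [w0 w00 T'K]]]; [left|right]; split.
- by move=> w w'; rewrite !TE => /(can_inj PhiK)/T'I.
- pose q : {linear V -> k^o} := p \o P.
  exists q; split.
    by move=> a; have [v pv] := pS a; exists (Phi v); rewrite /= PhiK.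
  move=> v; rewrite /= pK; split=> -[w hw]; exists w.
    by rewrite TE hw PsiK.
  by rewrite -hw TE PhiK.
- by move=> v; have [w hw] := T'S (Psi v); exists w; rewrite TE hw PsiK.
- exists w0 => // v; rewrite -T'K TE; split=> [h|->]; last exact: linear0.
  by apply: (can_inj PhiK); rewrite h linear0.
Qed.

End StalkDimension.

(** * Geometry of the tube *)

Section Tube.
Context {R : realType} {a : ambient}.
Context (K : R -> ambient_space R a) (tau : R * (R * R) -> ambient_space R a).
Hypothesis htau : tubular_neighborhood K tau.
Hypothesis hK : oriented_knot K.

Let D : set (R * (R * R)) := [set p | p.2.1 ^+ 2 + p.2.2 ^+ 2 < 2 ^+ 2].

Lemma tube_continuous : {within D, continuous tau}.
Proof.
have [_ smooth _ _ _] := htau.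
apply/subspace_continuousP => x Dx W nW.
have [C [nC CW]] := set_val_nbhs nW.
have := smooth 0%N x Dx _ (open_nbhs_nbhs nC).
by rewrite /= !nbhs_simpl /within /=; apply: filterS => y Cy _; exact: CW.
Qed.

Lemma tube_core t : tau (t, (0, 0)) = K t.
Proof. by have [h _ _ _ _] := htau. Qed.

Lemma tube_off_core p : D p -> p.2 != (0, 0) -> (~` range K) (tau p).
Proof.
have [core _ _ inj _] := htau.
move=> Dp p0 [t _]; rewrite -core => e; move/eqP: p0; apply.
have D0 : D (t, (0, 0)) by rewrite /D /=; nra.
by have [<- _] := proj1 (inj _ _ D0 Dp) e.
Qed.

Lemma tube_periodic t (n : int) v : D (t, v) -> tau (t + n%:~R, v) = tau (t, v).
Proof.
have [_ _ _ inj _] := htau => Dv.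
have Dn : D (t + n%:~R, v) by [].
by apply: (proj2 (inj _ _ Dn Dv)); split=> //; exists n.
Qed.

Lemma knot_period t (n : int) : K (t + n%:~R) = K t.
Proof. by have [_ _ per] := hK; apply/per; exists n. Qed.

Lemma knot_continuous : continuous K.
Proof.
have [smooth _ _] := hK => x W nW.
have [C [nC CW]] := set_val_nbhs nW.
have := smooth 0%N x I _ (open_nbhs_nbhs nC).
by rewrite /= !nbhs_simpl /=; apply: filterS => y; exact: CW.
Qed.

Definition scale (r : R) (v : R * R) : R * R := (r * v.1, r * v.2).

Definition rot (s : R) (v : R * R) : R * R :=
  (cos (2 * pi * s) * v.1 - sin (2 * pi * s) * v.2,
   sin (2 * pi * s) * v.1 + cos (2 * pi * s) * v.2).

Lemma rot0 v : rot 0 v = v.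
Proof. by case: v => x y; rewrite /rot !mulr0 cos0 sin0 /=; congr pair; ring. Qed.

Lemma rot1 v : rot 1 v = v.
Proof.
case: v => x y; rewrite /rot mulr1 mulr_natl cos2pi sin2pi /=.
by congr pair; ring.
Qed.

Lemma rot_circle s v : unit_circle v -> unit_circle (rot s v).
Proof.
rewrite /unit_circle /= => v1.
have := cos2Dsin2 (2 * pi * s); move: (cos _) (sin _) => x y xy.
transitivity ((x ^+ 2 + y ^+ 2) * (v.1 ^+ 2 + v.2 ^+ 2)); first by ring.
by rewrite xy v1 mulr1.
Qed.

Lemma scale1 v : scale 1 v = v.
Proof. by case: v => x y; rewrite /scale !mul1r. Qed.

Lemma scale_disk t r v : unit_circle v -> 0 <= r <= 1 -> D (t, scale r v).
Proof.
by rewrite /unit_circle /D /= => v1 r01; rewrite !exprMn -mulrDr v1; nra.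
Qed.

Lemma circle_disk t v : unit_circle v -> D (t, v).
Proof. by rewrite /unit_circle /D /= => ->; nra. Qed.

Lemma scale_neq0 r v : unit_circle v -> 0 < r -> scale r v != (0, 0).
Proof.
rewrite /unit_circle /= => v1 r0; apply/eqP => -[/eqP].
rewrite mulf_eq0 gt_eqF//= => /eqP e1 /eqP; rewrite mulf_eq0 gt_eqF//= => /eqP e2.
by move: v1; rewrite e1 e2; nra.
Qed.

Lemma circle_neq0 (v : R * R) : unit_circle v -> v != (0, 0).
Proof. by move=> v1; rewrite -(scale1 v); exact: scale_neq0. Qed.

Lemma within_rot (S : topologicalType) (A : set S) (f : S -> R) (g : S -> R * R) :
  {within A, continuous f} -> {within A, continuous g} ->
  {within A, continuous (fun x => rot (f x) (g x))}.
Proof.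
move=> cf cg.
have c2 : {within A, continuous (fun x => 2 * pi * f x)}.
  by apply: within_mul => //; exact: within_cst.
have cc : {within A, continuous (fun x => cos (2 * pi * f x))}.
  by move=> x; apply: (cvg_comp _ _ (c2 x)); exact: continuous_cos.
have cs : {within A, continuous (fun x => sin (2 * pi * f x))}.
  by move=> x; apply: (cvg_comp _ _ (c2 x)); exact: continuous_sin.
have g1 := within_fst cg; have g2 := within_snd cg.
apply: within_pair; [apply: within_sub|apply: within_add]; exact: within_mul.
Qed.

Lemma within_scale (S : topologicalType) (A : set S) (f : S -> R) (g : S -> R * R) :
  {within A, continuous f} -> {within A, continuous g} ->
  {within A, continuous (fun x => scale (f x) (g x))}.
Proof.
move=> cf cg; have g1 := within_fst cg; have g2 := within_snd cg.
by apply: within_pair; exact: within_mul.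
Qed.

Lemma square_fst (U : topologicalType) (h : R -> U) :
  {within `[0, 1], continuous h} ->
  {within unit_square, continuous (fun q : R * R => h q.1)}.
Proof.
move=> ch.
have cf : {within unit_square, continuous (fst : R * R -> R)}.
  by apply: continuous_subspaceT => ?; exact: cvg_fst.
by apply: (within_comp cf ch) => -[s t] /unit_squareP[? ?]; exact/unit_intervalP.
Qed.

Lemma within_tube (S : topologicalType) (A : set S) (f : S -> R) (g : S -> R * R) :
  {within A, continuous f} -> {within A, continuous g} ->
  (forall x, A x -> D (f x, g x)) ->
  {within A, continuous (fun x => tau (f x, g x))}.
Proof. by move=> cf cg AD; exact: (within_comp (within_pair cf cg) tube_continuous). Qed.

Section Curve.
Context (h : R -> R) (p : R -> R * R).
Hypothesis ch : {within `[0, 1], continuous h}.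
Hypothesis cp : {within `[0, 1], continuous p}.
Hypothesis p1 : forall s, 0 <= s <= 1 -> unit_circle (p s).

(** The curve s |-> (h s, p s) on the boundary of the tube, shrunk radially onto
    the knot as the second coordinate goes to 1. *)
Definition cone (q : R * R) : ambient_space R a :=
  tau (h q.1, scale (1 - q.2) (p q.1)).

Lemma cone_continuous : {within unit_square, continuous cone}.
Proof.
apply: within_tube; first exact: square_fst.
  apply: within_scale; last exact: square_fst.
  apply: within_sub; first exact: within_cst.
  by apply: continuous_subspaceT => ?; exact: cvg_snd.
by move=> -[s t] /unit_squareP[s01 t01]; apply: scale_disk; [exact: p1|rewrite /=; lra].
Qed.

Lemma cone_off_knot s t : 0 <= s <= 1 -> 0 <= t < 1 -> (~` range K) (cone (s, t)).
Proof.
move=> s01 t01; apply: tube_off_core; first by apply: scale_disk; [exact: p1|rewrite /=; lra].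
by apply: scale_neq0; [exact: p1|rewrite /=; lra].
Qed.

Lemma cone_core s : cone (s, 1) = K (h s).
Proof. by rewrite /cone /= subrr /scale !mul0r tube_core. Qed.

(** The torus swept by the meridians through the points of the curve. *)
Definition torus (q : R * R) : ambient_space R a := tau (h q.1, rot q.2 (p q.1)).

Lemma torus_continuous : {within unit_square, continuous torus}.
Proof.
apply: within_tube; first exact: square_fst.
  apply: within_rot; last exact: square_fst.
  by apply: continuous_subspaceT => ?; exact: cvg_snd.
by move=> -[s t] /unit_squareP[s01 t01]; apply/circle_disk/rot_circle/p1.
Qed.

Lemma torus_off_knot q : unit_square q -> (~` range K) (torus q).
Proof.
case: q => s t /unit_squareP[s01 t01].
have c1 : unit_circle (rot t (p s)) by apply/rot_circle/p1.
by apply: tube_off_core; [exact: circle_disk|exact: circle_neq0].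
Qed.

End Curve.

End Tube.

(** * Small balls *)

Section SpaceBall.
Context {R : realType} {a : ambient}.
Implicit Types x y : ambient_space R a.

Lemma space_ball_center x r : 0 < r -> space_ball x r x.
Proof.
move=> r0; rewrite /space_ball /= subrr /dot big1 ?exprn_gt0// => i _.
by rewrite mxE mul0r.
Qed.

Lemma space_ball_open x r : open (space_ball x r).
Proof.
have cont : continuous (fun y => dot (emb y - emb x) (emb y - emb x)).
  move=> y; apply: cvg_big; first exact: add_continuous.
    exact: nbhs_filter.
  move=> i _.
  have ci : (emb z - emb x) 0 i @[z --> y] --> (emb y - emb x) 0 i.
    have ce : emb z - emb x @[z --> y] --> emb y - emb x.
      have cemb : emb z @[z --> y] --> emb y by exact: (@set_val_cont _ _ y).
      apply: cvgB cemb _; exact: cvg_cst.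
    have cc := @coord_continuous _ _ _ 0 i (emb y - emb x).
    exact: (cvg_comp _ _ ce cc).
  exact: (cvgM ci ci).
apply: (@open_comp _ _ _ [set u | u < r ^+ 2]); first by move=> y _; exact: cont.
exact: open_lt.
Qed.

Lemma space_ball_small x U : open_nbhs x U ->
  exists2 r0, 0 < r0 & forall r, 0 < r <= r0 -> space_ball x r `<=` U.
Proof.
move=> nU; have [C [nC CU]] := set_val_nbhs (open_nbhs_nbhs nU).
have /nbhs_ballP[e /= e0 eC] := open_nbhs_nbhs nC.
exists e => // r /andP[r0 re] y hy; apply: CU; apply: eC.
split=> // i j; rewrite !ord1 /ball /=.
have yj : ((emb y - emb x) 0 j) ^+ 2 < r ^+ 2.
  apply: le_lt_trans hy; rewrite /dot (bigD1 j)//= -expr2 lerDl.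
  by apply: sumr_ge0 => l _; rewrite -expr2 sqr_ge0.
rewrite distrC; apply: lt_le_trans re.
by rewrite -(@ltr_pXn2r _ 2)// ?nnegrE// ?ltW// real_normK ?num_real//; move: yj; rewrite !mxE.
Qed.

End SpaceBall.

(** * The sheaf near the knot *)

Section KnotSheaf.
Context {R : realType} {k : fieldType} {a : ambient}.
Context (K : R -> ambient_space R a) (tau : R * (R * R) -> ambient_space R a).
Hypothesis hK : oriented_knot K.
Hypothesis htau : tubular_neighborhood K tau.
Context (t0 : R) (p0 : R * R) (b : knot_complement K).
Hypothesis hp0 : unit_circle p0.
Hypothesis hb : set_val b = tau (t0, p0).
Context (F : sheaf k (ambient_space R a)).
Hypothesis hF : knot_constructible K F.

Let V := stalk F (set_val b).
Let W := stalk F (K t0).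

Lemma complement_evenly_covered : evenly_covered F (~` range K).
Proof. by apply: local_system_evenly_covered; case: hF. Qed.

Lemma knot_evenly_covered : evenly_covered F (range K).
Proof. by apply: local_system_evenly_covered; case: hF. Qed.

Lemma finite_dim_complement : finite_dim V.
Proof. by apply: (local_system_finite_dim (f := set_val)); case: hF. Qed.

Lemma finite_dim_knot : finite_dim W.
Proof.
have Kt0 : K t0 \in range K by apply: mem_set; exists t0.
have [_ ls] := hF.
exact: (local_system_finite_dim (exist _ (K t0) Kt0 : set_type (range K)) ls).
Qed.

(** It starts at the base point at time 0 and reaches the knot at time 1, since
    transport runs backwards in time. *)
Definition exit_path (t : R) : ambient_space R a := tau (t0, scale (1 - t) p0).

Lemma exit_path0 : exit_path 0 = set_val b.
Proof. by rewrite /exit_path subr0 scale1 hb. Qed.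

Lemma exit_path1 : exit_path 1 = K t0.
Proof. exact: (cone_core htau (fun=> t0) (fun=> p0) 0). Qed.

Lemma exit_path_off_knot t : 0 <= t < 1 -> (~` range K) (exit_path t).
Proof.
apply: (@cone_off_knot _ _ _ _ htau (fun=> t0) (fun=> p0) _ 0 t) => //.
by lra.
Qed.

Lemma exit_path_continuous : {within `[0, 1], continuous exit_path}.
Proof.
have cc : {within unit_square, continuous (cone tau (fun=> t0) (fun=> p0))}.
  by apply: (cone_continuous htau) => //; exact: within_cst.
have cp : {within `[0, 1], continuous (fun t : R => (0 : R, t))}.
  by apply: within_pair; [exact: within_cst|exact: within_id].
apply: (within_comp cp cc) => t /unit_intervalP ?.
by apply/unit_squareP; split=> //; lra.
Qed.

Lemma exit_uniq (g h h' : etale F) :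
  transports exit_path g h -> transports exit_path g h' -> h = h'.
Proof.
exact: (transports_uniq complement_evenly_covered exit_path_continuous
  exit_path_off_knot).
Qed.

Lemma exit_map : exists T : {linear W -> V}, forall w : W,
  transports exit_path (existT (stalk F) (K t0) w) (existT (stalk F) (set_val b) (T w)).
Proof.
apply: transport_linear; last exact: exit_path0; last exact: exit_uniq.
move=> w; apply: (transports_exists_exit complement_evenly_covered
  knot_evenly_covered exit_path_continuous exit_path_off_knot).
  by rewrite exit_path1; exists t0.
by rewrite exit_path1.
Qed.

Section ExitMap.
Context (T : {linear W -> V}).
Hypothesis TE : forall w : W,
  transports exit_path (existT (stalk F) (K t0) w) (existT (stalk F) (set_val b) (T w)).

(** Near the knot the exit map is the restriction map of a small ball: a ball so
    small that every germ at its centre extends to it, which makes the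
    restriction map unique. The rest of the path is an isomorphism. *)
Lemma exit_map_simple : simple_sheaf K F -> simple_map T.
Proof.
move=> /(_ (K t0))[|r0 r00 hr]; first by exists t0.
have [U [nU ext]] := germs_extend finite_dim_knot.
have [r1 r10 hr1] := space_ball_small nU.
pose r := Num.min (r0 / 2) r1.
have rr0 : r <= r0 / 2 by rewrite /r ge_min lexx.
have rr1 : r <= r1 by rewrite /r ge_min lexx orbT.
have rpos : 0 < r by rewrite /r lt_min; lra.
pose B := space_ball (K t0) r.
have oB : open B by exact: space_ball_open.
have nB : open_nbhs (K t0) B by split=> //; exact: space_ball_center.
have BU : B `<=` U by apply: hr1; lra.
have nB1 : open_nbhs (exit_path 1) B by rewrite exit_path1.
have := within_open_nbhs exit_path_continuous (unit_interval1 (R := R)) nB1.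
move=> /nbhs_ballP[e /= e0 he].
pose t1 := Num.max 2^-1 (1 - e / 2).
have t1h : 2^-1 <= t1 by rewrite /t1 le_max lexx.
have t1e : 1 - e / 2 <= t1 by rewrite /t1 le_max lexx orbT.
have t11 : t1 < 1 by rewrite /t1 gt_max; lra.
have inB t : t1 <= t <= 1 -> B (exit_path t).
  move=> t1t; apply: he; last by apply/unit_intervalP; lra.
  by rewrite /ball /= ltr_distl; lra.
pose y := exit_path t1.
have By : B y by apply: inB; lra.
have Zy : (~` range K) y by apply: exit_path_off_knot; lra.
have rr : 0 < r < r0 by lra.
have [T' T'E simpT'] := hr r rr y By Zy.
pose c t := exit_path (t1 * t + 0).
have c1 : c 1 = y by rewrite /c mulr1 addr0.
have c0 : c 0 = set_val b by rewrite /c mulr0 addr0 exit_path0.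
have c01 t : 0 <= t <= 1 -> 0 <= t1 * t + 0 <= 1 by nra.
have cZ t : 0 <= t <= 1 -> (~` range K) (c t).
  by move=> t01; apply: exit_path_off_knot; nra.
have cc : {within `[0, 1], continuous c}.
  have ca : {within `[0, 1], continuous (fun t : R => t1 * t + 0)}.
    exact/continuous_subspaceT/contR_affine.
  apply: (within_comp ca exit_path_continuous) => t /unit_intervalP t01.
  by apply/unit_intervalP; exact: c01.
have evZ := complement_evenly_covered.
have cZ' t : 0 <= t < 1 -> (~` range K) (c t) by move=> ?; apply: cZ; lra.
have [Phi PhiE] : exists Phi : {linear stalk F y -> V}, forall v,
    transports c (existT (stalk F) y v) (existT (stalk F) (set_val b) (Phi v)).
  apply: transport_linear => //.
    by move=> v; apply: (transports_exists evZ cc cZ).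
  by move=> g h h'; exact: (transports_uniq evZ cc cZ').
have PhiS v : exists w, Phi w = v.
  have [|[z w] tr] := transports_exists_start (h := existT (stalk F) _ v) evZ cc cZ.
    by rewrite c0.
  have [/= zc _] := transports_tag tr; rewrite c1 in zc; subst z.
  exists w; apply: existT_inj2.
  exact: (transports_uniq evZ cc cZ' (PhiE w) tr).
have PhiI : injective Phi.
  move=> v v' e'; apply: existT_inj2.
  have := PhiE v; rewrite e' => tr.
  exact: (transports_inj evZ cc cZ tr (PhiE v')).
have [Psi PsiK] := choice PhiS.
have bPhi : bijective Phi by exists Psi => // v; apply: PhiI; rewrite PsiK.
apply: (simple_map_iso bPhi _ simpT') => w.
have [u uw] := ext w.
pose s := res F B u.
have sw : germ F (K t0) s = w by rewrite germ_res//; case: nU.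
have [sig [ls sig1 sig0]] := TE w.
have seg t : (`[t1, 1]%classic : set R) t <-> t1 <= t <= 1 by rewrite /= in_itv.
have subs : (`[t1, 1]%classic : set R) `<=` `[0, 1]%classic.
  by move=> t /seg ?; apply/unit_intervalP; lra.
have cs : {within `[t1, 1], continuous exit_path}.
  exact: continuous_subspaceW subs exit_path_continuous.
have sigE : sig t1 = germ_at s y.
  have lg : is_lift (`[t1, 1]%classic : set R) exit_path (germ_at s \o exit_path).
    by apply: lift_germ_at => // t /seg; exact: inB.
  have s1 : (`[t1, 1]%classic : set R) 1 by apply/seg; lra.
  apply: (lift_unique evZ (@segment_connected R t1 1) cs (lift_sub subs ls) lg s1).
  - by rewrite sig1 /= exit_path1 /germ_at sw.
  - move=> t /seg tt ne.
    have t1' : t < 1.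
      rewrite lt_neqAle; apply/andP; split; last lra.
      apply/eqP => te; apply: ne.
      by rewrite te sig1 /= exit_path1 /germ_at sw.
    apply: filterS (lt_nbhsl t1') => t' /= t'1 /seg t'01.
    by apply: exit_path_off_knot; lra.
  - by apply/seg; lra.
apply: existT_inj2; apply: (transports_uniq evZ cc cZ' _ (PhiE (T' w))).
exists (sig \o (fun t => t1 * t + 0)); split.
- apply: lift_comp ls _ _; first exact/continuous_subspaceT/contR_affine.
  by move=> t /unit_intervalP t01; apply/unit_intervalP; exact: c01.
- by rewrite /= mulr1 addr0 sigE /germ_at -T'E sw.
- by rewrite /= mulr0 addr0.
Qed.

(** The sheaf has a section over the cone of the loop, which is a square: its
    vertical sides are two copies of the exit path, its bottom is the loop and
    its top the shadow of the loop on the knot. *)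
Lemma tube_loop_monodromy (h : R -> R) (p : R -> R * R) (n : int) (c : loop R b)
    (w w' : W) :
  {within `[0, 1], continuous h} -> {within `[0, 1], continuous p} ->
  (forall s, 0 <= s <= 1 -> unit_circle (p s)) ->
  h 0 = t0 -> h 1 = t0 + n%:~R -> p 0 = p0 -> p 1 = p0 ->
  (forall s, 0 <= s <= 1 -> set_val (c s) = tau (h s, p s)) ->
  transports (K \o h) (existT (stalk F) (K t0) w) (existT (stalk F) (K t0) w') ->
  pi1_monodromy (loop_class c) (T w) = T w'.
Proof.
move=> ch cp cu h0 h1 pp0 pp1 cE trK.
have i0 : 0 <= (0 : R) <= 1 by lra.
have i1 : 0 <= (1 : R) <= 1 by lra.
have evZ := complement_evenly_covered; have evK := knot_evenly_covered.
pose f := cone tau h p.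
have fK s : f (s, 1) = K (h s) by exact: cone_core.
have e1 : tag (existT (stalk F) (K t0) w) = f (1, 1).
  by rewrite fK h1 (knot_period hK).
have [||s [ls s11]] := exit_square_lift evZ evK (cone_continuous htau ch cp cu) _ _ i1 e1.
- by move=> s t s01 t01; exact: (cone_off_knot htau).
- by move=> s s01; rewrite -/f fK; exists (h s).
have right : s (1, 0) = existT (stalk F) (set_val b) (T w).
  apply: exit_uniq (TE w); rewrite -s11.
  apply: transports_ext (lift_vertical ls i1) => t t01.
  rewrite /cone /= h1 pp1 (tube_periodic htau)//.
  by apply: scale_disk => //; lra.
have top : s (0, 1) = existT (stalk F) (K t0) w'.
  have cKh : {within `[0, 1], continuous (K \o h)}.
    have cK : {within setT, continuous K}.
      exact: continuous_subspaceT (knot_continuous hK).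
    exact: (within_comp ch cK).
  apply: (transports_uniq evK cKh _ _ trK); first by move=> t _; exists (h t).
  rewrite -s11; apply: transports_ext (lift_horizontal ls i1) => t t01.
  exact: fK.
have left_ : s (0, 0) = existT (stalk F) (set_val b) (T w').
  apply: exit_uniq (TE w'); rewrite -top.
  by apply: transports_ext (lift_vertical ls i0) => t t01; rewrite /cone /= h0 pp0.
apply: (pi1_monodromyE evZ); rewrite -right -left_.
apply: transports_ext (lift_horizontal ls i0) => t t01.
by rewrite cE// /cone /= subr0 scale1.
Qed.

End ExitMap.

(** Going from one corner to the opposite one of the square that sweeps the
    torus, the two ways round its boundary are the two orders of transport. *)
Lemma meridian_longitude_commute (h : R -> R) (p : R -> R * R) (n : int)
    (m l : loop R b) (v : V) :
  {within `[0, 1], continuous h} -> {within `[0, 1], continuous p} ->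
  (forall s, 0 <= s <= 1 -> unit_circle (p s)) ->
  h 0 = t0 -> h 1 = t0 + n%:~R -> p 0 = p0 -> p 1 = p0 ->
  (forall s, 0 <= s <= 1 -> set_val (l s) = tau (h s, p s)) ->
  (forall s, 0 <= s <= 1 -> set_val (m s) = tau (t0, rot s p0)) ->
  pi1_monodromy (loop_class m) (pi1_monodromy (loop_class l) v) =
  pi1_monodromy (loop_class l) (pi1_monodromy (loop_class m) v).
Proof.
move=> ch cp cu h0 h1 pp0 pp1 lE mE.
have i0 : 0 <= (0 : R) <= 1 by lra.
have i1 : 0 <= (1 : R) <= 1 by lra.
have i01 : (0 : R) <= 1 by lra.
have evZ := complement_evenly_covered.
have lf := rect_liftable i01 i01 evZ (torus_continuous htau ch cp cu)
  (torus_off_knot htau cu).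
have Dr s : 0 <= s <= 1 -> unit_circle (rot s p0) by move=> _; exact: rot_circle.
have e1 : tag (existT (stalk F) (set_val b) v) = torus tau h p (1, 1).
  by rewrite /torus /= h1 pp1 rot1 (tube_periodic htau) ?hb//; exact: circle_disk.
have r11 : rect 0 1 0 1 (1 : R, 1 : R) by apply/rectP.
have [s [ls s11]] := lf (1, 1) _ r11 e1.
have mt x t : 0 <= t <= 1 -> h x = t0 \/ h x = t0 + n%:~R -> p x = p0 ->
    torus tau h p (x, t) = set_val (m t).
  move=> t01 hx px; rewrite mE// /torus /= px.
  by case: hx => ->//; rewrite (tube_periodic htau)//; exact/circle_disk/Dr.
have lt0 x : 0 <= x <= 1 -> torus tau h p (x, 0) = set_val (l x).
  by move=> x01; rewrite lE// /torus /= rot0.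
have lt1 x : 0 <= x <= 1 -> torus tau h p (x, 1) = set_val (l x).
  by move=> x01; rewrite lE// /torus /= rot1.
have trans (c : loop R b) (q q' : etale F) (g : R -> ambient_space R a) u :
    (forall t, 0 <= t <= 1 -> g t = set_val (c t)) ->
    transports g q q' -> q = existT (stalk F) (set_val b) u ->
    q' = existT (stalk F) (set_val b) (pi1_monodromy (loop_class c) u).
  move=> gc tr qE; have tr2 := transports_ext gc tr; rewrite qE in tr2.
  exact: (loop_transports_uniq evZ tr2 (pi1_monodromy_transports evZ c u)).
have right := trans m _ _ _ v (fun t t01 => mt 1 t t01 (or_intror h1) pp1)
  (lift_vertical ls i1) s11.
have bottom := trans l _ _ _ _ lt0 (lift_horizontal ls i0) right.
have top := trans l _ _ _ v lt1 (lift_horizontal ls i1) s11.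
have left_ := trans m _ _ _ _ (fun t t01 => mt 0 t t01 (or_introl h0) pp0)
  (lift_vertical ls i0) top.
by apply: existT_inj2; rewrite -bottom -left_.
Qed.

(** Any path h from t0 to t0 + 1 can replace the standard parametrization of the
    knot, as the two are homotopic inside the knot; this applies to the shadow
    of the longitude, which need not move at constant speed. *)
Lemma core_transport (h : R -> R) : {within `[0, 1], continuous h} ->
  h 0 = t0 -> h 1 = t0 + 1 ->
  exists T : {linear W -> W}, [/\ injective T,
    (fun w => T w) = rho_core K F t0 &
    forall w, transports (K \o h) (existT (stalk F) (K t0) w)
      (existT (stalk F) (K t0) (T w))].
Proof.
move=> ch h0 h1.
have evK := knot_evenly_covered.
have K1 : K (t0 + 1) = K t0 by exact: (knot_period hK t0 1).
pose c t := K (t0 + t).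
have cc : {within `[0, 1], continuous c}.
  apply: continuous_subspaceT => t; apply: continuous_comp.
    by apply: cvgD; [exact: cvg_cst|exact: cvg_id].
  exact: knot_continuous.
have cK t : range K (c t) by exists (t0 + t).
have uniq (g g' g'' : etale F) : transports c g g' -> transports c g g'' -> g' = g''.
  by apply: (transports_uniq evK cc).
have c0 : c 0 = K t0 by rewrite /c addr0.
have [T TE] : exists T : {linear W -> W}, forall w,
    transports c (existT (stalk F) (K t0) w) (existT (stalk F) (K t0) (T w)).
  apply: transport_linear => // v.
  by apply: (transports_exists evK cc) => //; rewrite /c K1.
exists T; split.
- move=> v v' e; apply: existT_inj2; have := TE v; rewrite e => tr.
  by apply: (transports_inj evK cc _ tr (TE v')).
- by apply/funext => w; rewrite /rho_core (monodromyE uniq (TE w)).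
move=> w.
(* the affine homotopy from t0 + q.2 to h q.2, read on the knot *)
pose f (q : R * R) := K (q.1 * h q.2 + (1 - q.1) * (t0 + q.2)).
have csnd : {within unit_square, continuous (snd : R * R -> R)}.
  by apply: continuous_subspaceT => ?; exact: cvg_snd.
have cfst : {within unit_square, continuous (fst : R * R -> R)}.
  by apply: continuous_subspaceT => ?; exact: cvg_fst.
have ch2 : {within unit_square, continuous (fun q : R * R => h q.2)}.
  apply: (within_comp csnd ch) => -[s t] /unit_squareP[_ ?].
  exact/unit_intervalP.
have cf : {within unit_square, continuous f}.
  have cin : {within unit_square, continuous
      (fun q : R * R => q.1 * h q.2 + (1 - q.1) * (t0 + q.2))}.
    apply: within_add; apply: within_mul => //.
      by apply: within_sub => //; exact: within_cst.
    by apply: within_add => //; exact: within_cst.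
  have cKT : {within setT, continuous K}.
    exact: continuous_subspaceT (knot_continuous hK).
  exact: (within_comp cin cKT).
have tr1 : transports (fun t => f (1, t)) (existT (stalk F) (K t0) w)
    (existT (stalk F) (K t0) (T w)).
  apply: (transports_homotopy evK cf (x := K t0) (y := K (t0 + 1))).
  - by move=> q _; exists (q.1 * h q.2 + (1 - q.1) * (t0 + q.2)).
  - by move=> s s01; rewrite /f /= h0 h1; split; congr K; ring.
  - apply: transports_ext (TE w) => t _; rewrite /f /c /=; congr K; ring.
by apply: transports_ext tr1 => t _; rewrite /f /=; congr K; ring.
Qed.

End KnotSheaf.

Theorem theorem4p4 (R : realType) (k : fieldType) (a : ambient)
  (K : R -> ambient_space R a) (hK : oriented_knot K)
  (tau : R * (R * R) -> ambient_space R a) (htau : tubular_neighborhood K tau)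
  (S : set (ambient_space R a)) (hS : seifert_surface K S)
  (t0 : R) (p0 : R * R) (b : knot_complement K)
  (hp0 : unit_circle p0) (hb : set_val b = tau (t0, p0))
  (m l : loop R b)
  (hm : meridian tau t0 p0 (fun s => set_val (m s)))
  (hl : longitude tau S t0 p0 (fun s => set_val (l s)))
  (F : sheaf k (ambient_space R a))
  (hF : knot_constructible K F) (hsimple : simple_sheaf K F) :
  let mer := loop_class m in
  let lon := loop_class l in
  exists epsilon : {rmorphism cord_algebra mer lon -> k},
    [/\ epsilon (cord_lambda mer lon) =
          trace (rho F lon) - trace (rho_core K F t0),
        epsilon (cord_mu mer lon) =
          trace (rho F mer) - (dimension (stalk F (set_val b)))%:R + 1 &
        forall g : pi1 R b, epsilon (cord mer lon g) =
          trace (rho F g \- rho F (mer * g)%g)].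
Proof.
move=> mer lon.
have [h [p [[ch cp] [[h0 h1] [pp0 pp1]] hlE _ _]]] := hl.
have cu s : 0 <= s <= 1 -> unit_circle (p s) by move=> /hlE[].
have lE s : 0 <= s <= 1 -> set_val (l s) = tau (h s, p s) by move=> /hlE[].
have mE s : 0 <= s <= 1 -> set_val (m s) = tau (t0, rot s p0).
  by move=> s01; rewrite hm.
have evZ := complement_evenly_covered hF.
have [rhoL rhoE] := choice (fun g : pi1 R b => pi1_monodromy_linear evZ g).
have [T TE] := exit_map htau hp0 hb hF.
have [r' [r'I r'E r'T]] := core_transport hK hF ch h0 h1.
have rE g : rho F g = rhoL g by rewrite -rhoE.
have rel : cord_relations mer lon (trace (rhoL lon) - trace r')
    (trace (rhoL mer) - (dimension (stalk F (set_val b)))%:R + 1)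
    (fun g => trace (rhoL g \- rhoL (mer * g)%g)).
  apply: (cord_relations_simple (T := T)) => //.
  - exact: finite_dim_complement.
  - exact: finite_dim_knot.
  - by move=> v; rewrite -rhoE (pi1_monodromy1 evZ).
  - by move=> g g' v; rewrite -!rhoE (pi1_monodromyM evZ).
  - move=> v; rewrite -!rhoE.
    exact: (meridian_longitude_commute htau hp0 hb hF (n := 1) v ch cp cu).
  - move=> w; rewrite -rhoE /mer.
    apply: (tube_loop_monodromy hK htau hp0 hF TE (h := fun=> t0)
      (p := fun s => rot s p0) (n := 0)) => //.
    + exact: within_cst.
    + by apply: within_rot; [exact: within_id|exact: within_cst].
    + by move=> s _; exact: rot_circle.
    + by rewrite addr0.
    + by rewrite rot0.
    + by rewrite rot1.
    + by apply: (constant_transport _ (knot_evenly_covered hF)); exists t0.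
  - move=> w; rewrite -rhoE /lon.
    exact: (tube_loop_monodromy hK htau hp0 hF TE (n := 1) ch cp cu).
  - exact: (exit_map_simple htau hp0 hb hF TE).
have [eps [e1 e2 e3]] := cord_augmentation rel.
exists eps; split=> [||g]; rewrite ?e1 ?e2 ?e3 ?rE//.
by rewrite -r'E.
Qed.
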